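(* For every integer $\alpha\ge 1$, with $\psi:=\left\lfloor \frac{3^{\alpha+1}}{8}\right\rfloor$ and $\beta:=2\lfloor\alpha/2\rfloor+1$, we have $$\frac{(1+9x)^{\psi}}{3^{\beta}}\cdot L_{\alpha}\in\mathbb{Z}[x],$$ i.e. the $q$-series $3^{-\beta}(1+9x)^{\psi}L_\alpha$ equals a polynomial in the $q$-series $x$ with integer coefficients.
   Context: Notation: $(a;q)_\infty=\prod_{j\ge 0}(1-aq^j)$, $q=e^{2\pi i\tau}$ with $\tau$ in the upper half plane (or $q$ a formal variable). The function $d_2(n)$ is defined by $\sum_{n\ge 0} d_2(n)q^n=\dfrac{(q^2;q^2)_\infty^{2}}{(q;q)_\infty^{7}}$. Set $$x=q\frac{(q^2;q^2)_\infty(q^6;q^6)_\infty^5}{(q;q)_\infty^5(q^3;q^3)_\infty}.$$ For $\alpha\ge1$ let $\lambda_{2\alpha-1}=\frac{1+5\cdot 3^{2\alpha-1}}{8}$ and $\lambda_{2\alpha}=\frac{1+7\cdot 3^{2\alpha}}{8}$, and define $$L_{2\alpha-1}=\frac{(q^3;q^3)_\infty^7}{(q^6;q^6)_\infty^2}\sum_{n\ge 0} d_2(3^{2\alpha-1}n+\lambda_{2\alpha-1})q^{n+1},\qquad L_{2\alpha}=\frac{(q;q)_\infty^7}{(q^2;q^2)_\infty^2}\sum_{n\ge 0} d_2(3^{2\alpha}n+\lambda_{2\alpha})q^{n+1}.$$ *)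

(* Defs.v *)
From HB Require Import structures.
From mathcomp Require Import all_boot all_order all_algebra.
From mathcomp Require Import boolp.

Set Implicit Arguments.
Unset Strict Implicit.
Unset Printing Implicit Defensive.

Import GRing.Theory.
Local Open Scope ring_scope.

(* Formal power series in one variable q.  They are wrapped in a record so that
   the Cauchy product does not clash with the pointwise product that MathComp
   puts on the function type nat -> R. *)
Record fps (R : Type) : Type := Fps { fcoef : nat -> R }.

Notation "{ 'fps' R }" := (fps R) (format "{ 'fps'  R }") : type_scope.

Lemma fpsP (R : Type) (f g : {fps R}) : (forall n, fcoef f n = fcoef g n) <-> f = g.
Proof.
split=> [fg|-> //]; case: f g fg => [f] [g] /= fg.
by congr Fps; apply: funext.
Qed.

HB.instance Definition _ (R : Type) := gen_eqMixin {fps R}.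
HB.instance Definition _ (R : Type) := gen_choiceMixin {fps R}.

Section FpsZmodule.
Variable R : zmodType.
Implicit Types f g : {fps R}.

Definition fps_zero : {fps R} := Fps (fun=> 0).
Definition fps_opp f : {fps R} := Fps (fun n => - fcoef f n).
Definition fps_add f g : {fps R} := Fps (fun n => fcoef f n + fcoef g n).

Fact fps_addA : associative fps_add.
Proof. by move=> f g h; apply/fpsP => n /=; rewrite addrA. Qed.
Fact fps_addC : commutative fps_add.
Proof. by move=> f g; apply/fpsP => n /=; rewrite addrC. Qed.
Fact fps_add0 : left_id fps_zero fps_add.
Proof. by move=> f; apply/fpsP => n /=; rewrite add0r. Qed.
Fact fps_addN : left_inverse fps_zero fps_opp fps_add.
Proof. by move=> f; apply/fpsP => n /=; rewrite addNr. Qed.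

HB.instance Definition _ :=
  GRing.isZmodule.Build {fps R} fps_addA fps_addC fps_add0 fps_addN.

Lemma fcoef0 n : fcoef (0 : {fps R}) n = 0. Proof. by []. Qed.
Lemma fcoefN f n : fcoef (- f) n = - fcoef f n. Proof. by []. Qed.
Lemma fcoefD f g n : fcoef (f + g) n = fcoef f n + fcoef g n. Proof. by []. Qed.
Lemma fcoefB f g n : fcoef (f - g) n = fcoef f n - fcoef g n. Proof. by []. Qed.

Lemma fcoef_sum (I : Type) (r : seq I) (P : pred I) (F : I -> {fps R}) n :
  fcoef (\sum_(i <- r | P i) F i) n = \sum_(i <- r | P i) fcoef (F i) n.
Proof. by elim/big_rec2: _ => // i _ f _ <-. Qed.

End FpsZmodule.

Section FpsComRing.
Variable R : comNzRingType.
Implicit Types f g h : {fps R}.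

Definition fps_one : {fps R} := Fps (fun n => (n == 0%N)%:R).
Definition fps_mul f g : {fps R} :=
  Fps (fun n => \sum_(i < n.+1) fcoef f i * fcoef g (n - i)%N).

Let tr N f : {poly R} := \poly_(i < N) fcoef f i.

Let tr_mul N f g n : (n < N)%N -> fcoef (fps_mul f g) n = (tr N f * tr N g)`_n.
Proof.
move=> nN; rewrite coefM /=; apply: eq_bigr => i _.
by rewrite !coef_poly (leq_ltn_trans (leq_ord i) nN)
  (leq_ltn_trans (leq_subr i n) nN).
Qed.

Fact fps_mulC : commutative fps_mul.
Proof. by move=> f g; apply/fpsP => n; rewrite !(tr_mul _ _ (ltnSn n)) mulrC. Qed.
Fact fps_mulA : associative fps_mul.
Proof.
move=> f g h; apply/fpsP => n.
transitivity (tr n.+1 f * tr n.+1 g * tr n.+1 h)`_n.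
  rewrite -mulrA coefM /=; apply: eq_bigr => i _.
  by rewrite -tr_mul ?ltnS ?leq_subr // coef_poly ltn_ord.
rewrite coefM /=; apply: eq_bigr => i _.
by rewrite -tr_mul // coef_poly ltnS leq_subr.
Qed.
Fact fps_mul1 : left_id fps_one fps_mul.
Proof.
move=> f; apply/fpsP => n /=.
by rewrite big_ord_recl /= mul1r subn0 big1 ?addr0 // => i _; rewrite mul0r.
Qed.
Fact fps_mulDl : left_distributive fps_mul (@fps_add R).
Proof.
move=> f g h; apply/fpsP => n /=.
by rewrite -big_split; apply: eq_bigr => i _; rewrite mulrDl.
Qed.
Fact fps_one_neq0 : fps_one != 0.
Proof. by apply/eqP => /fpsP /(_ 0%N) /eqP; rewrite /= oner_eq0. Qed.

HB.instance Definition _ := GRing.Zmodule_isComNzRing.Build {fps R}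
  fps_mulA fps_mulC fps_mul1 fps_mulDl fps_one_neq0.

Lemma fcoef1 n : fcoef (1 : {fps R}) n = (n == 0%N)%:R. Proof. by []. Qed.
Lemma fcoefM f g n :
  fcoef (f * g) n = \sum_(i < n.+1) fcoef f i * fcoef g (n - i)%N.
Proof. by []. Qed.
Lemma fcoefM0 f g : fcoef (f * g) 0 = fcoef f 0 * fcoef g 0.
Proof. by rewrite fcoefM big_ord1. Qed.

Definition fpsC (c : R) : {fps R} := Fps (fun n => if n == 0%N then c else 0).
Definition fpsX : {fps R} := Fps (fun n => (n == 1%N)%:R).

Lemma fcoefCM c f n : fcoef (fpsC c * f) n = c * fcoef f n.
Proof.
by rewrite fcoefM big_ord_recl /= subn0 big1 ?addr0 // => i _; rewrite mul0r.
Qed.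

Lemma fcoefXM f n : fcoef (fpsX * f) n = if n is m.+1 then fcoef f m else 0.
Proof.
rewrite fcoefM; case: n => [|n]; first by rewrite big_ord1 mul0r.
rewrite !big_ord_recl /= mul0r add0r mul1r subSS subn0.
by rewrite big1 ?addr0 // => i _; rewrite mul0r.
Qed.

Lemma fcoefMl_eq0 f g m : (forall i, (i < m)%N -> fcoef g i = 0) ->
  forall i, (i < m)%N -> fcoef (f * g) i = 0.
Proof.
move=> g0 i im; rewrite fcoefM big1 // => j _.
by rewrite g0 ?mulr0 // (leq_ltn_trans (leq_subr j i) im).
Qed.

Lemma fcoefX_eq0 f m : fcoef f 0 = 0 ->
  forall i, (i < m)%N -> fcoef (f ^+ m) i = 0.
Proof.
move=> f0; elim: m => [//|m IH] i im; rewrite exprS fcoefM big1 // => -[[|j] ji] _ /=.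
  by rewrite f0 mul0r.
by rewrite IH ?mulr0 //; rewrite ltnS in im; case: i im ji => [//|i] im ji;
  rewrite subSS (leq_ltn_trans (leq_subr j i) im).
Qed.

(* The infinite product (a; q)_oo = \prod_(j >= 0) (1 - a * q ^ j), for a series
   q with zero constant term: the factors with j > n do not contribute to the
   coefficient of index n (see fcoef_qpoch). *)
Definition qpoch (a q : {fps R}) : {fps R} :=
  Fps (fun n => fcoef (\prod_(j < n.+1) (1 - a * q ^+ j)) n).

Lemma fcoef_qpoch (a q : {fps R}) n N : fcoef q 0 = 0 -> (n < N)%N ->
  fcoef (qpoch a q) n = fcoef (\prod_(j < N) (1 - a * q ^+ j)) n.
Proof.
move=> q0; elim: N => [//|N IH]; rewrite ltnS leq_eqVlt => /predU1P[-> //|nN].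
rewrite big_ord_recr [X in _ = fcoef X n]mulrBr mulr1 fcoefB -IH // mulrA.
by rewrite (fcoefMl_eq0 _ (fcoefX_eq0 q0) nN) subr0.
Qed.

Lemma fcoef_qpoch0 (a q : {fps R}) : fcoef (qpoch a q) 0 = 1 - fcoef a 0.
Proof. by rewrite /= big_ord1 mulr1. Qed.

(* (q^k; q^k)_oo, meaningful for k > 0 *)
Definition euler (k : nat) : {fps R} := qpoch (fpsX ^+ k) (fpsX ^+ k).

Lemma fcoef_euler0 k : (0 < k)%N -> fcoef (euler k) 0 = 1.
Proof. by move=> k0; rewrite fcoef_qpoch0 fcoefX_eq0 // subr0. Qed.

End FpsComRing.

Arguments fpsX {R}.
Arguments euler {R} k.

Section FpsUnitRing.
Variable R : comUnitRingType.
Implicit Types f g : {fps R}.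

Definition fps_unit : {pred {fps R}} := fun f => fcoef f 0 \is a GRing.unit.

(* f = c (1 - u) with u of zero constant term, so that f^-1 = c^-1 \sum_i u^i. *)
Definition fps_geom f : {fps R} :=
  let c := fpsC (fcoef f 0)^-1 in
  let u := 1 - c * f in
  c * Fps (fun n => fcoef (\sum_(i < n.+1) u ^+ i) n).

Definition fps_inv f : {fps R} := if f \in fps_unit then fps_geom f else f.

Fact fps_mulV : {in fps_unit, left_inverse 1 fps_inv *%R}.
Proof.
move=> f fU; rewrite /fps_inv fU /fps_geom.
set c := fpsC _; set u := 1 - c * f; set s := Fps _.
have u0 : fcoef u 0 = 0.
  by rewrite fcoefB fcoefCM mulVr // subrr.
have sE n N : (n < N)%N -> fcoef s n = fcoef (\sum_(i < N) u ^+ i) n.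
  elim: N => [//|N IH]; rewrite ltnS leq_eqVlt => /predU1P[-> //|nN].
  by rewrite big_ord_recr fcoefD -IH // (fcoefX_eq0 u0) // addr0.
rewrite mulrAC (_ : c * f = 1 - u); last by rewrite opprB addrC subrK.
apply/fpsP => n.
transitivity (fcoef ((1 - u) * \sum_(i < n.+1) u ^+ i) n).
  by rewrite !fcoefM; apply: eq_bigr => i _; rewrite (sE _ n.+1) // ltnS leq_subr.
rewrite -opprB mulNr -subrX1 opprB fcoefB (fcoefX_eq0 u0) //.
by rewrite subr0.
Qed.

Fact fps_unitPl f g : g * f = 1 -> fps_unit f.
Proof.
move=> /fpsP/(_ 0%N); rewrite fcoefM0 fcoef1 /= => gf.
by apply/unitrPr; exists (fcoef g 0); rewrite mulrC.
Qed.

Fact fps_inv_out : {in [predC fps_unit], fps_inv =1 id}.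
Proof. by move=> f /negbTE fU; rewrite /fps_inv fU. Qed.

HB.instance Definition _ := GRing.ComNzRing_hasMulInverse.Build {fps R}
  fps_mulV fps_unitPl fps_inv_out.

Lemma fps_unitE f : (f \is a GRing.unit) = (fcoef f 0 \is a GRing.unit).
Proof. by []. Qed.

Lemma euler_unit k : (0 < k)%N -> (euler k : {fps R}) \is a GRing.unit.
Proof. by move=> k0; rewrite fps_unitE fcoef_euler0 ?unitr1. Qed.

End FpsUnitRing.

Lemma fps_natr_unit (n : nat) : (0 < n)%N -> (n%:R : {fps rat}) \is a GRing.unit.
Proof.
move=> n0; rewrite fps_unitE (_ : fcoef _ 0 = n%:R) ?unitfE ?Num.Theory.pnatr_eq0 -?lt0n //.
by elim: n {n0} => [|n IH] //; rewrite !mulrS fcoefD IH.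
Qed.

Definition d2 (n : nat) : rat := fcoef (euler 2 ^+ 2 / euler 1 ^+ 7) n.

Definition xser : {fps rat} :=
  fpsX * ((euler 2 * euler 6 ^+ 5) / (euler 1 ^+ 5 * euler 3)).

(* Both quotients are exact: see lambda_exact. *)
Definition lambda (alpha : nat) : nat :=
  (if odd alpha then (1 + 5 * 3 ^ alpha) %/ 8 else (1 + 7 * 3 ^ alpha) %/ 8)%N.

Lemma lambda_exact (alpha : nat) :
  (8 * lambda alpha = 1 + (if odd alpha then 5 else 7) * 3 ^ alpha)%N.
Proof.
rewrite /lambda -(fun_if (fun c => (1 + c * 3 ^ alpha) %/ 8)%N) mulnC divnK //.
have E : (3 ^ alpha = (if odd alpha then 3 else 1) %[mod 8])%N.
  elim: alpha => [//|n IH]; rewrite expnS -modnMmr IH modnMmr /=.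
  by case: (odd n).
by rewrite /dvdn -modnDmr -modnMmr E modnMmr modnDmr; case: (odd alpha).
Qed.

(* The sum over n of d2(3^alpha n + lambda_alpha) q^(n+1). *)
Definition d2_section (alpha : nat) : {fps rat} :=
  fpsX * Fps (fun n => d2 (3 ^ alpha * n + lambda alpha)).

Definition L (alpha : nat) : {fps rat} :=
  if odd alpha then euler 3 ^+ 7 / euler 6 ^+ 2 * d2_section alpha
  else euler 1 ^+ 7 / euler 2 ^+ 2 * d2_section alpha.

(* Main.v *)
Require Import Defs.
From Stdlib Require Import ZArith.
From HB Require Import structures.
From mathcomp Require Import all_boot all_order all_algebra.
From mathcomp Require Import boolp ring zify ssrZ.

(** Let [t = q f_3 f_18^3 / (f_6 f_9^3)], with [f_k = (q^k; q^k)_oo]: it is [q] times a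
   series in [q^3], and the 3-dissections of [f_1^2 / f_2] and [f_2^2 / f_1] (Jacobi's
   triple product) read [1 - 2 t = f_1^2 f_18 / (f_2 f_9^2)] and
   [1 + t = f_2^2 f_3 f_18 / (f_1 f_6 f_9^2)].  Taking norms from [q] to [q^3] gives
   [1 - 8 t^3] and [1 + t^3] as eta quotients.  Hence, with [w = t / (1 - 2 t)] and
   [W = 3 w],
     [x = w + 3 w^2 + 3 w^3],  [1 + 9 x = (1 + W)^3],
     [w^3 = x(q^3) (12 w^2 + 6 w + 1)],
   so that [U_3] is the normalised trace of [Z[x(q^3), w]] over [Z[x(q^3)]], and [L] is
   obtained by iterating alternately [U_3 (A .)] and [U_3], where
   [A = w (1 + 2 w)^4 / (1 + W)].  Powers of [1 + 9 x] in the denominator are controlled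
   by [(1 + W) sigma = 1 + 9 x(q^3)].  The powers of 3 come from two lattices of integral
   polynomials in [x]: [Z_k], where [3^(j - k)] divides the coefficient of [x^j], and
   [M_1 = Z (x - x^2) + Z (x^2 - x^3) + 9 Z_4].  Up to powers of [1 + 9 x],
   [U_3 (A .)] maps [Z_3] to [M_1] and [1] to [3 M_1], while [U_3] maps [M_1] to [9 Z_3];
   as the lattices are modules over rings such as [Z[9 x]], this reduces to finitely many
   integer computations. *)

Set Implicit Arguments.
Unset Strict Implicit.
Unset Printing Implicit Defensive.

Import Order.TTheory GRing.Theory Num.Theory.
Local Open Scope ring_scope.

(** * Power series modulo [q^n] *)

Definition eqmod (R : zmodType) (n : nat) (f g : {fps R}) :=
  forall i, (i < n)%N -> fcoef f i = fcoef g i.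

Section Congruence.
Variable R : comNzRingType.
Implicit Types f g h : {fps R}.

Lemma eqmod_eq f g : (forall n, eqmod n f g) -> f = g.
Proof. by move=> fg; apply/fpsP => n; apply: (fg n.+1). Qed.

Lemma eqmod_sym n f g : eqmod n f g -> eqmod n g f.
Proof. by move=> fg i /fg. Qed.

Lemma eqmod_trans n g f h : eqmod n f g -> eqmod n g h -> eqmod n f h.
Proof. by move=> fg gh i lin; rewrite fg // gh. Qed.

Lemma eqmod_le m n f g : (m <= n)%N -> eqmod n f g -> eqmod m f g.
Proof. by move=> mn fg i im; apply: fg; apply: leq_trans mn. Qed.

Lemma eqmodD n f f' g g' :
  eqmod n f f' -> eqmod n g g' -> eqmod n (f + g) (f' + g').
Proof. by move=> ff gg i lin; rewrite !fcoefD ff ?gg. Qed.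

Lemma eqmod_sum (I : Type) (r : seq I) (P : pred I) n (F G : I -> {fps R}) :
  (forall i, P i -> eqmod n (F i) (G i)) ->
  eqmod n (\sum_(i <- r | P i) F i) (\sum_(i <- r | P i) G i).
Proof. by move=> FG j jn; rewrite !fcoef_sum; apply: eq_bigr => i /FG ->. Qed.

Lemma eqmodM n f f' g g' :
  eqmod n f f' -> eqmod n g g' -> eqmod n (f * g) (f' * g').
Proof.
move=> ff gg i lin; rewrite !fcoefM; apply: eq_bigr => j _.
by rewrite ff ?gg //; apply: leq_ltn_trans lin; rewrite ?leq_subr // -ltnS.
Qed.

Lemma eqmodX n k f f' : eqmod n f f' -> eqmod n (f ^+ k) (f' ^+ k).
Proof. by move=> ff; elim: k => // k IH; rewrite !exprS; apply: eqmodM. Qed.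

Lemma eqmod_mul0 m n f g : eqmod m f 0 -> eqmod n g 0 -> eqmod (m + n) (f * g) 0.
Proof.
move=> f0 g0 i imn; rewrite fcoefM fcoef0 big1 // => -[j /= ji] _.
case: (ltnP j m) => [/f0 ->|mj]; first by rewrite fcoef0 mul0r.
by rewrite (g0 (i - j)%N) ?fcoef0 ?mulr0 //; lia.
Qed.

Lemma eqmodMl m n f g h :
  eqmod m h 0 -> eqmod n f g -> eqmod (m + n) (h * f) (h * g).
Proof.
move=> h0 fg i imn; apply/eqP; rewrite -subr_eq0 -fcoefB -mulrBr.
apply/eqP; apply: (eqmod_mul0 h0) imn => j /fg.
by rewrite fcoefB => ->; rewrite subrr.
Qed.

Lemma eqmodX0 k f : fcoef f 0 = 0 -> eqmod k (f ^+ k) 0.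
Proof. by move=> f0 i ik; rewrite fcoefX_eq0. Qed.

Lemma eqmod_qpoch (a q : {fps R}) n : fcoef q 0 = 0 ->
  eqmod n (qpoch a q) (\prod_(j < n) (1 - a * q ^+ j)).
Proof. by move=> q0 i lin; apply: fcoef_qpoch. Qed.

Lemma fcoefXn k n : fcoef (fpsX ^+ k : {fps R}) n = (n == k)%:R.
Proof.
elim: k n => [|k IH] n; first by rewrite expr0.
by rewrite exprS fcoefXM; case: n.
Qed.

Lemma fcoefXn0 k : (0 < k)%N -> fcoef (fpsX ^+ k : {fps R}) 0 = 0.
Proof. by rewrite fcoefXn; case: k. Qed.

End Congruence.

Lemma eqmod_cancel (R : comUnitRingType) n (u f g : {fps R}) :
  u \is a GRing.unit -> eqmod n (u * f) (u * g) -> eqmod n f g.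
Proof.
move=> uU fg; rewrite -[f](mulKr uU) -[g](mulKr uU).
exact: eqmodM.
Qed.

Section Domain.
Variable R : idomainType.

Fact fps_idomain (f g : {fps R}) : f * g = 0 -> (f == 0) || (g == 0).
Proof.
move=> fg0; have [//|f0] := eqVneq f 0; have [//|g0] := eqVneq g 0.
have lead (h : {fps R}) : h != 0 ->
  exists2 n, fcoef h n != 0 & forall i, (i < n)%N -> fcoef h i = 0.
  move=> h0; have nz : exists n, fcoef h n != 0.
    apply: contrapT => hn; case/eqP: h0; apply/fpsP => n.
    by apply/eqP; apply: contrapT => /negP hn'; apply: hn; exists n.
  exists (ex_minn nz); first by case: ex_minnP.
  case: ex_minnP => n _ mn i lin; apply/eqP; apply: contraTT lin => /mn.
  by rewrite leqNgt.
have [m fm fi] := lead f f0; have [n gn gi] := lead g g0.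
have /fpsP/(_ (m + n)%N) := fg0; rewrite fcoefM fcoef0.
rewrite (bigD1 (@Ordinal (m + n).+1 m _)) /= ?ltnS ?leq_addr // => lmn.
rewrite addKn big1 ?addr0 => [/eqP|[i /= lti] neq].
  by rewrite mulf_eq0 (negbTE fm) (negbTE gn).
have [im|mi|im] := ltngtP i m.
- by rewrite fi ?mul0r.
- by rewrite gi ?mulr0 //; lia.
- by case/eqP: neq; apply: val_inj.
Qed.

HB.instance Definition _ := GRing.ComUnitRing_isIntegral.Build {fps R} fps_idomain.
End Domain.

(** * The 3-dissection of a series and its norm *)

Section Dissection.
Variable R : comNzRingType.
Implicit Types f g h : {fps R}.

(* [part3 0] is the operator [U_3]. *)
Definition part3 (r : nat) f : {fps R} := Fps (fun n => fcoef f (3 * n + r)).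

(* [f(q^3)]. *)
Definition fps_cube f : {fps R} :=
  Fps (fun n => if (3 %| n)%N then fcoef f (n %/ 3) else 0).

Lemma fcoef_part3 r f n : fcoef (part3 r f) n = fcoef f (3 * n + r).
Proof. by []. Qed.

Lemma part3D r f g : part3 r (f + g) = part3 r f + part3 r g.
Proof. exact/fpsP. Qed.

Lemma fcoef_cube f n : fcoef (fps_cube f) (3 * n) = fcoef f n.
Proof. by rewrite /= dvdn_mulr // mulKn. Qed.

Lemma fcoef_cube_eq0 f n r : (0 < r < 3)%N -> fcoef (fps_cube f) (3 * n + r) = 0.
Proof. by move=> r03; rewrite /= ifF //; lia. Qed.

Lemma sum_cube n (F : nat -> R) :
  (forall i, (~~ (3 %| i))%N -> F i = 0) ->
  \sum_(i < (3 * n).+1) F i = \sum_(i < n.+1) F (3 * i)%N.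
Proof.
move=> F0; elim: n => [|n IH]; first by rewrite muln0 !big_ord1.
rewrite mulnS 3!big_ord_recr IH [RHS]big_ord_recr /= -mulnS.
rewrite (F0 (3 * n).+1) ?(F0 (3 * n).+2); [|lia..].
by rewrite !addr0.
Qed.

Lemma fps_cube_zmod : zmod_morphism fps_cube.
Proof. by move=> f g; apply/fpsP => n /=; case: ifP; rewrite ?subrr. Qed.

Lemma part3_cubeM r f g : (r < 3)%N -> part3 r (fps_cube f * g) = f * part3 r g.
Proof.
move=> r3; apply/fpsP => n; rewrite !fcoefM.
transitivity (\sum_(i < (3 * n).+1) fcoef (fps_cube f) i * fcoef g (3 * n + r - i)%N).
  rewrite fcoef_part3 fcoefM.
  rewrite -!(big_mkord xpredT (fun i => fcoef (fps_cube f) i * fcoef g (3 * n + r - i)%N)).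
  rewrite -addSn (@big_cat_nat _ _ _ (3 * n).+1) //= ?leq_addr //.
  rewrite [X in _ + X]big_nat_cond [X in _ + X]big1 ?addr0 // => i.
  rewrite andbT => /andP[i1 i2].
  by rewrite ifF ?mul0r //; lia.
rewrite (@sum_cube n (fun i => fcoef (fps_cube f) i * fcoef g (3 * n + r - i)%N)).
  apply: eq_bigr => i _; rewrite fcoef_cube fcoef_part3; congr (_ * fcoef g _).
  by have := ltn_ord i; lia.
by move=> i i3; rewrite /= (negbTE i3) mul0r.
Qed.

Lemma part3_cube f : part3 0 (fps_cube f) = f.
Proof. by apply/fpsP => n; rewrite /part3 /= addn0 dvdn_mulr // mulKn. Qed.

Lemma part3_cube0 r f : (0 < r < 3)%N -> part3 r (fps_cube f) = 0.
Proof. by move=> r3; apply/fpsP => n; apply: fcoef_cube_eq0. Qed.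

Lemma part3_XM r f : part3 r.+1 (fpsX * f) = part3 r f.
Proof. by apply/fpsP => n; rewrite !fcoef_part3 addnS fcoefXM. Qed.

Lemma part3_XM0 f : part3 0 (fpsX * f) = fpsX * part3 2 f.
Proof.
apply/fpsP => -[|n]; rewrite !fcoef_part3 ?addn0 !fcoefXM // mulnS.
by rewrite fcoef_part3 (addnC _ 2).
Qed.

Lemma part3_inj f g : (forall r, (r < 3)%N -> part3 r f = part3 r g) -> f = g.
Proof.
move=> fg; apply/fpsP => n.
have /fpsP/(_ (n %/ 3)%N) := fg (n %% 3)%N (ltn_pmod n (isT : (0 < 3)%N)).
by rewrite /= mulnC -divn_eq.
Qed.

Lemma part3_dissect r (a b c : {fps R}) : (r < 3)%N ->
  part3 r (fps_cube a + fpsX * fps_cube b + fpsX ^+ 2 * fps_cube c) =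
    nth 0 [:: a; b; c] r.
Proof.
rewrite !part3D expr2 -mulrA.
case: r => [|[|[|//]]] _; rewrite ?part3_XM0 ?part3_XM ?part3_XM0 ?part3_XM.
- by rewrite part3_cube !part3_cube0 // !mulr0 !addr0.
- by rewrite part3_cube !part3_cube0 // mulr0 add0r addr0.
- by rewrite part3_cube !part3_cube0 // !add0r.
Qed.

Lemma dissect3 f :
  f = fps_cube (part3 0 f) + fpsX * fps_cube (part3 1 f)
      + fpsX ^+ 2 * fps_cube (part3 2 f).
Proof.
by apply: part3_inj => r r3; rewrite part3_dissect //; case: r r3 => [|[|[|]]].
Qed.

Lemma fps_cube_monoid : monoid_morphism fps_cube.
Proof.
split.
  apply: part3_inj => -[|[|[|//]]] _; rewrite ?part3_cube ?part3_cube0 //;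
    by apply/fpsP => n; rewrite fcoef_part3 fcoef1 ?fcoef0; case: n.
move=> f g; apply: part3_inj => r r3; rewrite part3_cubeM //.
case: r r3 => [|r] r3; first by rewrite !part3_cube.
by rewrite !part3_cube0 ?mulr0.
Qed.

HB.instance Definition _ :=
  GRing.isZmodMorphism.Build {fps R} {fps R} fps_cube fps_cube_zmod.
HB.instance Definition _ :=
  GRing.isMonoidMorphism.Build {fps R} {fps R} fps_cube fps_cube_monoid.

Lemma fps_cubeX : fps_cube fpsX = fpsX ^+ 3.
Proof.
apply: part3_inj => r r3; rewrite (exprSr _ 2) expr2 -mulrA.
case: r r3 => [|[|[|//]]] _.
- rewrite part3_cube part3_XM0 part3_XM; apply/fpsP => n.
  rewrite fcoefXM; case: n => [|n] //=; congr (_ %:R); lia.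
- rewrite part3_cube0 // part3_XM part3_XM0 -[fpsX]mulr1 part3_XM.
  by rewrite -[1](rmorph1 fps_cube) part3_cube0 ?mulr0.
- rewrite part3_cube0 // !part3_XM -[fpsX]mulr1 part3_XM0.
  by rewrite -[1](rmorph1 fps_cube) part3_cube0 ?mulr0.
Qed.

Lemma fcoef_cube0 f : fcoef (fps_cube f) 0 = fcoef f 0.
Proof. by rewrite -(fcoef_cube f 0). Qed.

Lemma eqmod_cube n f g : eqmod n f g -> eqmod n (fps_cube f) (fps_cube g).
Proof. by move=> fg i lin /=; case: ifP => // _; rewrite fg //; lia. Qed.

Lemma cube_qpoch (a q : {fps R}) : fcoef q 0 = 0 ->
  fps_cube (qpoch a q) = qpoch (fps_cube a) (fps_cube q).
Proof.
move=> q0; apply: eqmod_eq => n.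
apply: eqmod_trans (eqmod_cube (eqmod_qpoch a q0)) _.
rewrite rmorph_prod; apply: eqmod_sym.
apply: eqmod_trans (eqmod_qpoch _ _) _; first by rewrite fcoef_cube0.
rewrite (eq_bigr (fun j : 'I_n => fps_cube (1 - a * q ^+ j))) // => j _.
by rewrite rmorphB rmorph1 rmorphM rmorphXn.
Qed.

Lemma cube_euler k : (0 < k)%N -> fps_cube (euler k) = euler (3 * k) :> {fps R}.
Proof.
move=> k0; rewrite /euler cube_qpoch ?fcoefXn0 //.
by rewrite rmorphXn /= fps_cubeX -exprM.
Qed.

(* The product of [f] at [q], [omega q] and [omega ^ 2 q], for [omega] a primitive
   cube root of unity, is [fps_cube (norm3 f)]. *)
Definition norm3 f : {fps R} :=
  part3 0 f ^+ 3 + fpsX * part3 1 f ^+ 3 + fpsX ^+ 2 * part3 2 f ^+ 3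
  - 3%:R * fpsX * (part3 0 f * part3 1 f * part3 2 f).

(** After [q^3 -> q] this is the norm form of the cubic extension by a cube root of [fpsX], so
    multiplicativity is a polynomial identity in the six components. *)
Lemma norm3M f g : norm3 (f * g) = norm3 f * norm3 g.
Proof.
rewrite [in LHS](dissect3 f) [in LHS](dissect3 g) /norm3.
move: (part3 0 f) (part3 1 f) (part3 2 f) (part3 0 g) (part3 1 g) (part3 2 g).
move=> f0 f1 f2 g0 g1 g2.
have -> : (fps_cube f0 + fpsX * fps_cube f1 + fpsX ^+ 2 * fps_cube f2) *
     (fps_cube g0 + fpsX * fps_cube g1 + fpsX ^+ 2 * fps_cube g2) =
   fps_cube (f0 * g0 + fpsX * (f1 * g2 + f2 * g1))
   + fpsX * fps_cube (f0 * g1 + f1 * g0 + fpsX * f2 * g2)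
   + fpsX ^+ 2 * fps_cube (f0 * g2 + f1 * g1 + f2 * g0).
  by rewrite !(rmorphD, rmorphM) /= fps_cubeX; ring.
by rewrite !part3_dissect //=; ring.
Qed.

Lemma norm3_cube f : norm3 (fps_cube f) = f ^+ 3.
Proof. by rewrite /norm3 part3_cube !part3_cube0 //; ring. Qed.

Lemma norm31 : norm3 1 = 1.
Proof. by rewrite -[X in norm3 X](rmorph1 fps_cube) norm3_cube expr1n. Qed.

Lemma norm3_1pX f : norm3 (1 + fpsX * fps_cube f) = 1 + fpsX * f ^+ 3.
Proof.
have -> : 1 + fpsX * fps_cube f =
    fps_cube 1 + fpsX * fps_cube f + fpsX ^+ 2 * fps_cube 0.
  by rewrite rmorph1 rmorph0; ring.
by rewrite /norm3 !part3_dissect //=; ring.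
Qed.

Lemma norm3_1pX2 f : norm3 (1 + fpsX ^+ 2 * fps_cube f) = 1 + fpsX ^+ 2 * f ^+ 3.
Proof.
have -> : 1 + fpsX ^+ 2 * fps_cube f =
    fps_cube 1 + fpsX * fps_cube 0 + fpsX ^+ 2 * fps_cube f.
  by rewrite rmorph1 rmorph0; ring.
by rewrite /norm3 !part3_dissect //=; ring.
Qed.

(** The three conjugates [1 - omega^(j n) q^n] multiply to [1 - q^(3 n)] if 3 does not divide [n],
    and all equal [1 - q^n] otherwise; then [q^3] is renamed [q]. *)
Lemma norm3_1BXn n : norm3 (1 - fpsX ^+ n) =
  if (3 %| n)%N then (1 - fpsX ^+ (n %/ 3)) ^+ 3 else 1 - fpsX ^+ n.
Proof.
have -> : (fpsX ^+ n : {fps R}) = fpsX ^+ (n %% 3)%N * fps_cube (fpsX ^+ (n %/ 3)).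
  by rewrite rmorphXn /= fps_cubeX -exprM -exprD mulnC addnC -divn_eq.
rewrite /dvdn; have := ltn_pmod n (isT : (0 < 3)%N).
case: (n %% 3)%N => [|[|[|//]]] _ /=.
- by rewrite mul1r -[X in X - _](rmorph1 fps_cube) -rmorphB norm3_cube.
- by rewrite expr1 -mulrN -rmorphN norm3_1pX rmorphN rmorphXn /= fps_cubeX exprAC; ring.
- by rewrite -mulrN -rmorphN norm3_1pX2 rmorphN rmorphXn /= fps_cubeX exprAC; ring.
Qed.

Lemma eqmod_part3 r n f g : eqmod (3 * n + r) f g -> eqmod n (part3 r f) (part3 r g).
Proof. by move=> fg i lin; apply: fg; lia. Qed.

Lemma eqmod_norm3 n f g : eqmod (3 * n + 2) f g -> eqmod n (norm3 f) (norm3 g).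
Proof.
move=> fg; have fgr r : (r < 3)%N -> eqmod n (part3 r f) (part3 r g).
  by move=> r3; apply: eqmod_part3; apply: eqmod_le fg; rewrite leq_add2l.
rewrite /norm3 -!mulNr; do ![apply: eqmodD || apply: eqmodM || apply: eqmodX] => //;
  exact: fgr.
Qed.

Lemma eqmod_euler k n N : (0 < k)%N -> (n <= N)%N ->
  eqmod n (euler k : {fps R}) (\prod_(j < N) (1 - fpsX ^+ (k * j.+1))).
Proof.
move=> k0 nN; apply: (eqmod_le nN); apply: eqmod_trans (eqmod_qpoch _ _) _.
  by rewrite fcoefXn0.
rewrite (eq_bigr (fun j : 'I_N => 1 - (fpsX : {fps R}) ^+ (k * j.+1))) // => j _.
by rewrite -exprM -exprD mulnS.
Qed.

(* Among three consecutive factors of [euler k], the norm keeps the two with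
   exponent prime to 3 and cubes the third after [q ^ 3 -> q]. *)
Lemma norm3_euler k : ~~ (3 %| k)%N ->
  norm3 (euler k) * euler (3 * k) = euler k ^+ 4 :> {fps R}.
Proof.
move=> k3; have k0 : (0 < k)%N by case: k k3.
pose E m : {fps R} := \prod_(j < m) (1 - fpsX ^+ (k * j.+1)).
pose E3 m : {fps R} := \prod_(j < m) (1 - fpsX ^+ (3 * k * j.+1)).
have normE m : norm3 (E (3 * m)%N) * E3 m = E (3 * m)%N * E m ^+ 3.
  elim: m => [|m IH]; first by rewrite muln0 /E /E3 !big_ord0 norm31 expr1n !mulr1.
  have -> : E (3 * m.+1)%N = E (3 * m)%N * (1 - fpsX ^+ (k * (3 * m).+1))
     * (1 - fpsX ^+ (k * (3 * m).+2)) * (1 - fpsX ^+ (3 * k * m.+1)).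
    rewrite /E (mulnS 3) !big_ord_recr /=.
    congr (_ * (1 - fpsX ^+ _)).
    by rewrite -[(3 * m).+3]/(3 + 3 * m)%N -mulnS mulnA (mulnC k).
  have -> : E m.+1 = E m * (1 - fpsX ^+ (k * m.+1)) by rewrite /E big_ord_recr.
  have -> : E3 m.+1 = E3 m * (1 - fpsX ^+ (3 * k * m.+1)) by rewrite /E3 big_ord_recr.
  rewrite !norm3M !norm3_1BXn -mulnA (dvdn_mulr _ (dvdnn 3)) mulKn //.
  rewrite !Euclid_dvdM // (negbTE k3) /= !ifF; [|lia|lia].
  by move: IH; set a := norm3 _ => IH; ring: IH.
apply: eqmod_eq => n.
apply: eqmod_trans (eqmodM (eqmod_norm3 _) (eqmod_euler _ (leqnn n))) _.
(* [eqmod_norm3] asks for precision [3 n + 2]; taking [3 (n + 2)] factors covers it and is a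
   multiple of 3, as [normE] needs. *)
- apply: (@eqmod_euler k _ (3 * (n + 2))) => //; lia.
- by rewrite muln_gt0.
rewrite -/(E _) -/(E3 _).
apply: eqmod_trans (_ : eqmod n _ (norm3 (E (3 * (n + 2))%N) * E3 (n + 2)%N)) _.
  apply: eqmodM => //; apply: eqmod_trans (eqmod_sym (eqmod_euler _ (leqnn n))) _;
    rewrite ?muln_gt0 //.
  by apply: eqmod_euler; rewrite ?muln_gt0 ?leq_addr.
rewrite normE (exprS (euler k)); apply: eqmod_sym; apply: eqmodM.
  by apply: eqmod_euler => //; lia.
by apply: eqmodX; apply: eqmod_euler => //; lia.
Qed.

End Dissection.

(** * Jacobi's triple product *)

Lemma bin2S n : ('C(n.+1, 2) = 'C(n, 2) + n)%N.
Proof. by rewrite binS bin1. Qed.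

Lemma bin2D m n : ('C(m + n, 2) = 'C(m, 2) + 'C(n, 2) + m * n)%N.
Proof.
elim: n => [|n IH]; first by rewrite addn0 muln0 !addn0.
by rewrite addnS !bin2S IH; lia.
Qed.

Lemma bin2_sqr n : ('C(n, 2) + 'C(n, 2) + n = n * n)%N.
Proof. by elim: n => // n; rewrite bin2S; lia. Qed.

Lemma bin2_ge n : (n.-1 <= 'C(n, 2))%N.
Proof. by case: n => // n; rewrite bin2S leq_addl. Qed.

(** * Gaussian binomial coefficients *)

Section QBinomial.
Variables (R : comNzRingType) (Q : R).

Fixpoint qbin (n k : nat) : R :=
  match k, n with
  | 0, _ => 1
  | _.+1, 0 => 0
  | k'.+1, n'.+1 => qbin n' k' + Q ^+ k * qbin n' k
  end.

Definition qfact (n : nat) : R := \prod_(i < n) (1 - Q ^+ i.+1).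

Lemma qbin0 n : qbin n 0 = 1. Proof. by case: n. Qed.

Lemma qbin_gt n k : (n < k)%N -> qbin n k = 0.
Proof.
elim: n k => [|n IH] [|k] //= nk.
by rewrite !IH ?mulr0 ?addr0 //; apply: ltnW.
Qed.

Lemma qfactS n : qfact n.+1 = qfact n * (1 - Q ^+ n.+1).
Proof. by rewrite /qfact big_ord_recr. Qed.

Lemma qbin_fact n k : (k <= n)%N -> qbin n k * qfact k * qfact (n - k) = qfact n.
Proof.
elim: n k => [|n IH] [|k] //.
- by rewrite /qfact !big_ord0 !mulr1.
- by rewrite /qfact big_ord0 qbin0 subn0 !mul1r.
rewrite ltnS subSS leq_eqVlt => /predU1P[->|kn].
  rewrite /= (qbin_gt (ltnSn n)) mulr0 addr0 subnn !qfactS.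
  by have := IH n (leqnn n); rewrite subnn => IHn; ring: IHn.
have /(congr1 ( *%R (1 - Q ^+ k.+1))) := IH k (ltnW kn).
have /(congr1 ( *%R (Q ^+ k.+1 * (1 - Q ^+ (n - k))))) := IH k.+1 kn.
have -> : (n - k = (n - k.+1).+1)%N by lia.
rewrite [qbin n.+1 _]/= !qfactS => E1 E0.
transitivity ((1 - Q ^+ k.+1) * qfact n
              + Q ^+ k.+1 * (1 - Q ^+ (n - k.+1).+1) * qfact n).
  by rewrite -E0 -E1; ring.
have -> : Q ^+ n.+1 = Q ^+ k.+1 * Q ^+ (n - k.+1).+1.
  by rewrite -exprD; congr (_ ^+ _); lia.
by ring.
Qed.

(** The first factor is [x + y] and the others form the same product at [(x, y Q)]; collecting
    powers of [y] gives the q-Pascal rule. *)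
Lemma qbinomial (x y : R) n :
  \prod_(j < n) (x + y * Q ^+ j) =
  \sum_(k < n.+1) qbin n k * Q ^+ 'C(k, 2) * x ^+ (n - k) * y ^+ k.
Proof.
elim: n x y => [|n IH] x y; first by rewrite big_ord0 big_ord1 /= !mulr1.
rewrite big_ord_recl /= mulr1.
under eq_bigr do rewrite /bump /= add1n exprS mulrA.
rewrite IH mulrDl !big_distrr /= [X in _ + X]big_ord_recr /= [RHS]big_ord_recl.
rewrite [X in X + _ = _]big_ord_recl.
rewrite [in RHS]big_ord_recr /= !subnn !qbin0 !bin0n !expr0 !mulr1 !mul1r subn0 addrA.
rewrite (qbin_gt (ltnSn n)) mulr0 addr0 -exprS -!addrA; congr (_ + _).
rewrite addrA -big_split /=; congr (_ + _).
  apply: eq_bigr => i _; rewrite /bump /= !add1n subSS !exprMn.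
  rewrite (_ : (n - i = (n - i.+1).+1)%N); last by have := ltn_ord i; lia.
  rewrite (exprS x) (exprS y) !bin2S !exprD (exprS Q).
  by ring.
by rewrite -[bump 0 n]/n.+1 add0n exprMn bin2S !exprD (exprS y); ring.
Qed.

End QBinomial.

(** * Partial theta sums *)

Section Theta.
Variable R : comNzRingType.
Implicit Types a b : R.

(** The term of index [n] of Ramanujan's [f(a, b)]; the term of index [-n] is [theta_term b a n]. *)
Definition theta_term a b n := a ^+ 'C(n.+1, 2) * b ^+ 'C(n, 2).

(* A partial sum of Ramanujan's [f(a, b) = \sum_n a^(n(n+1)/2) b^(n(n-1)/2)] over [-m <= n <= m]. *)
Definition theta_sum a b m :=
  \sum_(n < m.+1) theta_term a b n + \sum_(n < m) theta_term b a n.+1.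

Lemma theta_termE a b n : theta_term a b n = a ^+ n * (a * b) ^+ 'C(n, 2).
Proof. by rewrite /theta_term bin2S addnC exprD exprMn mulrA. Qed.

Lemma theta_sumS a b m :
  theta_sum a b m.+1 = theta_sum a b m + theta_term a b m.+1 + theta_term b a m.+1.
Proof. by rewrite /theta_sum big_ord_recr /= [X in _ + X]big_ord_recr /=; ring. Qed.

Let binom3 k : ('C((3 * k).+1, 2) = 6 * 'C(k.+1, 2) + 3 * 'C(k, 2))%N.
Proof.
elim: k => [|k IH] //; rewrite (mulnS 3) -[(3 + _)%N]/(3 * k).+3.
by rewrite !bin2S in IH *; lia.
Qed.

Let binom30 k : ('C(3 * k, 2) = 3 * 'C(k.+1, 2) + 6 * 'C(k, 2))%N.
Proof. by have := binom3 k; rewrite !bin2S; lia. Qed.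

Let exprMnM a b (i j k l u v : nat) :
  (a ^+ i * b ^+ j) ^+ u * (a ^+ k * b ^+ l) ^+ v =
  a ^+ (i * u + k * v) * b ^+ (j * u + l * v).
Proof. by rewrite !exprMn -!exprM !exprD; ring. Qed.

Lemma theta_term3 a b k :
  theta_term a b (3 * k) = theta_term (a ^+ 6 * b ^+ 3) (a ^+ 3 * b ^+ 6) k.
Proof. by rewrite /theta_term exprMnM binom3 binom30. Qed.

Lemma theta_term3S a b k :
  theta_term a b (3 * k).+1 = a * theta_term (a ^+ 9 * b ^+ 6) (b ^+ 3) k.
Proof.
rewrite /theta_term -[b ^+ 3]mul1r -[X in X * b ^+ 3](expr0 a) exprMnM mulrA -exprS.
congr (_ ^+ _ * _ ^+ _); rewrite ?binom3 // (bin2S (3 * k).+1) binom3 !bin2S.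
elim: k => // k IH; rewrite !bin2S in IH *; lia.
Qed.

Lemma theta_term3SS a b k :
  theta_term a b (3 * k).+2 = b * theta_term (a ^+ 3) (a ^+ 6 * b ^+ 9) k.+1.
Proof.
rewrite /theta_term -[a ^+ 3]mulr1 -[X in a ^+ 3 * X](expr0 b) exprMnM mulrCA -exprS.
by congr (_ ^+ _ * _ ^+ _); rewrite !(bin2S (_.+1)) !binom3 !bin2S;
  elim: k => // k IH; rewrite !bin2S in IH *; lia.
Qed.

(** Indices are split into the classes [3 k], [3 k + 1] and [3 k - 1]; with the bound [3 m + 1] each
    class runs over exactly [-m <= k <= m]. *)
Lemma theta_sum3 a b m :
  theta_sum a b (3 * m).+1 =
    theta_sum (a ^+ 6 * b ^+ 3) (a ^+ 3 * b ^+ 6) m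
    + a * theta_sum (a ^+ 9 * b ^+ 6) (b ^+ 3) m
    + b * theta_sum (a ^+ 3) (a ^+ 6 * b ^+ 9) m.
Proof.
elim: m => [|m IH].
  by rewrite /theta_sum !big_ord_recr !big_ord0 /theta_term /=; ring.
rewrite (mulnS 3) -[(3 + _)%N]/(3 * m).+3 3!theta_sumS {}IH.
rewrite -[(3 * m).+3]/(3 + 3 * m)%N -(mulnS 3) !theta_sumS.
rewrite !(theta_term3, theta_term3S, theta_term3SS).
by rewrite !(mulrC (b ^+ _)); ring.
Qed.

End Theta.

Definition jacobi (R : comNzRingType) (a b : {fps R}) : {fps R} :=
  qpoch (- a) (a * b) * qpoch (- b) (a * b) * qpoch (a * b) (a * b).

Section JacobiTripleProduct.
Variable R : idomainType.
Implicit Types a b : {fps R}.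

Lemma finite_triple_product a b m : a != 0 -> b != 0 ->
  \prod_(j < m) (1 + a * (a * b) ^+ j) * \prod_(j < m) (1 + b * (a * b) ^+ j) =
  \sum_(n < m.+1) qbin (a * b) (2 * m) (m + n) * theta_term a b n
  + \sum_(n < m) qbin (a * b) (2 * m) (m - n.+1) * theta_term b a n.+1.
Proof.
move=> a0 b0; set Q := a * b; have Q0 : Q != 0 by rewrite mulf_neq0.
(* This monomial turns the left side into the product of [Q^m + a Q^j] over [j < 2 m], ready for
   [qbinomial]: the factors with [j >= m] are [Q^m (1 + a Q^(j-m))], those with [j < m] are
   [a Q^j (1 + b Q^(m-1-j))], since [Q = a b]. *)
apply: (mulfI (mulf_neq0 (expf_neq0 (m * m + 'C(m, 2)) Q0) (expf_neq0 m a0))).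
transitivity (\prod_(j < 2 * m) (Q ^+ m + a * Q ^+ j)).
  rewrite mul2n -addnn big_split_ord /= mulrC.
  have -> : \prod_(i < m) (Q ^+ m + a * Q ^+ (m + i)) =
      Q ^+ (m * m) * \prod_(j < m) (1 + a * Q ^+ j).
    under eq_bigr do rewrite exprD mulrCA -[X in X + _]mulr1 -mulrDr.
    by rewrite big_split /= prodr_const card_ord exprM.
  have -> : \prod_(i < m) (Q ^+ m + a * Q ^+ i) =
      a ^+ m * Q ^+ 'C(m, 2) * \prod_(j < m) (1 + b * Q ^+ j).
    rewrite [in RHS](reindex_inj rev_ord_inj) /= -bin2_sum big_mkord.
    rewrite (big_morph (fun n => Q ^+ n) (exprD Q) (expr0 Q)).
    have -> : a ^+ m = \prod_(i < m) a by rewrite prodr_const card_ord.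
    rewrite -!big_split /=.
    apply: eq_bigr => i _; rewrite mulrDr mulr1 addrC; congr (_ + _).
    rewrite mulrACA -exprD -/Q -exprS; congr (_ ^+ _).
    by have := ltn_ord i; lia.
  by rewrite exprD; ring.
rewrite qbinomial -(big_mkord xpredT (fun k =>
  qbin Q (2 * m) k * Q ^+ 'C(k, 2) * (Q ^+ m) ^+ (2 * m - k) * a ^+ k)).
rewrite (@big_cat_nat _ _ _ m) //=; last by lia.
rewrite addrC mulrDr; congr (_ + _).
  rewrite -{1}[m]add0n big_addn (_ : ((2 * m).+1 - m = m.+1)%N); last by lia.
  rewrite big_mkord big_distrr /=; apply: eq_bigr => n _.
  rewrite theta_termE -/Q addnC bin2D -exprM.
  have -> : (m * (2 * m - (m + n)) = m * m - m * n)%N.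
    by rewrite -mulnBr; congr (_ * _)%N; lia.
  rewrite (_ : Q ^+ (m * m + 'C(m, 2)) = Q ^+ (m * n) * Q ^+ (m * m - m * n) * Q ^+ 'C(m, 2)).
    by rewrite !exprD; ring.
  rewrite -!exprD; congr (_ ^+ _); rewrite subnKC // leq_mul2l.
  by have := ltn_ord n; rewrite ltnS => ->; rewrite orbT.
rewrite big_mkord (reindex_inj rev_ord_inj) /= big_distrr /=.
apply: eq_bigr => n _; have nm := ltn_ord n.
rewrite theta_termE (mulrC b a) -/Q.
have [k mE] : exists k, m = (k + n.+1)%N by exists (m - n.+1)%N; lia.
rewrite -exprM {nm}; move: (nat_of_ord n) mE => {}n ->; move: n.+1 => p.
rewrite addnK (_ : (2 * (k + p) - k = k + 2 * p)%N); last by lia.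
have -> : Q ^+ ((k + p) * (k + p) + 'C(k + p, 2)) * a ^+ (k + p) *
    (qbin Q (2 * (k + p)) k * (b ^+ p * Q ^+ 'C(p, 2))) =
    qbin Q (2 * (k + p)) k * a ^+ k *
    Q ^+ ((k + p) * (k + p) + 'C(k + p, 2) + 'C(p, 2) + p).
  have Qp : Q ^+ p = a ^+ p * b ^+ p by rewrite -exprMn.
  by rewrite (exprD Q _ p) (exprD Q _ 'C(p, 2)) Qp (exprD a); ring.
have -> : ((k + p) * (k + p) + 'C(k + p, 2) + 'C(p, 2) + p =
    'C(k, 2) + (k + p) * (k + 2 * p))%N.
  by rewrite bin2D; have := bin2_sqr p; lia.
by rewrite exprD; ring.
Qed.

Lemma eqmod_qfact (Q : {fps R}) n : fcoef Q 0 = 0 ->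
  eqmod n.+1 (qpoch Q Q) (qfact Q n).
Proof.
move=> Q0; apply: eqmod_trans (eqmod_qpoch _ _) _ => //.
rewrite big_ord_recr /= /qfact -[X in eqmod _ _ X]mulr1.
under eq_bigr do rewrite -exprS.
apply: eqmodM => //; rewrite -exprS => i iln.
by rewrite fcoefB (eqmodX0 Q0) // subr0.
Qed.

(** As [k] and [n - k] grow, the Gaussian coefficient tends to [1 / (Q; Q)_oo]: modulo [q^(l+1)] the
    three factors [qfact] in [qbin_fact] all agree with the unit [qpoch Q Q]. *)
Lemma eqmod_qbin (Q : {fps R}) n k l : fcoef Q 0 = 0 ->
  (l + k <= n)%N -> (l <= k)%N -> eqmod l.+1 (qpoch Q Q * qbin Q n k) 1.
Proof.
move=> Q0 lkn lk; set E := qpoch Q Q.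
have EU : E \is a GRing.unit by rewrite fps_unitE fcoef_qpoch0 Q0 subr0 unitr1.
have Efact j : (l <= j)%N -> eqmod l.+1 E (qfact Q j).
  by move=> lj; apply: (@eqmod_le _ _ j.+1) => //; apply: eqmod_qfact.
apply: (eqmod_cancel EU); rewrite mulr1.
have -> : E * (E * qbin Q n k) = qbin Q n k * E * E by ring.
apply: (@eqmod_trans _ _ (qbin Q n k * qfact Q k * qfact Q (n - k))).
  by do 2?[apply: eqmodM] => //; apply: Efact => //; lia.
by rewrite qbin_fact; [apply/eqmod_sym/Efact; lia|lia].
Qed.

(** In the finite identity the coefficient at distance [n] from the centre, times [qpoch Q Q], is
    known to be 1 only modulo [q^(m-n+1)]; the theta term has valuation at least
    ['C(n, 2) >= n - 1], which makes up for the loss. *)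
Lemma jacobi_triple_product a b m : a != 0 -> b != 0 -> fcoef (a * b) 0 = 0 ->
  eqmod m (jacobi a b) (theta_sum a b m).
Proof.
move=> a0 b0 ab0; set Q := a * b.
have term c d n k : c * d = Q -> (n <= m)%N -> (k = m + n)%N \/ (k = m - n)%N ->
    eqmod m (qpoch Q Q * (qbin Q (2 * m) k * theta_term c d n)) (theta_term c d n).
  move=> cdQ nm kE.
  have cd0 : eqmod 'C(n, 2) (theta_term c d n) 0.
    rewrite theta_termE cdQ -[0](mulr0 (c ^+ n)).
    by apply: eqmodM => //; apply: eqmodX0.
  rewrite mulrA mulrC -[X in eqmod _ _ X]mulr1.
  apply: eqmod_le (eqmodMl cd0 (@eqmod_qbin Q (2 * m) k (m - n) ab0 _ _));
    have := bin2_ge n; lia.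
apply: (@eqmod_trans _ _ (\prod_(j < m) (1 + a * Q ^+ j) *
                         \prod_(j < m) (1 + b * Q ^+ j) * qpoch Q Q)).
  do 2?[apply: eqmodM] => //; apply: eqmod_trans (eqmod_qpoch _ ab0) _;
    by under eq_bigr do rewrite mulNr opprK.
rewrite finite_triple_product // -/Q mulrC mulrDr !big_distrr /=.
apply: eqmodD; apply: eqmod_sum => n _.
  by apply: term => //; [have := ltn_ord n; lia|left].
by apply: term; rewrite ?(mulrC b) //; right.
Qed.

Lemma jacobi_dissection a b : a != 0 -> b != 0 -> fcoef (a * b) 0 = 0 ->
  jacobi a b = jacobi (a ^+ 6 * b ^+ 3) (a ^+ 3 * b ^+ 6)
    + a * jacobi (a ^+ 9 * b ^+ 6) (b ^+ 3)
    + b * jacobi (a ^+ 3) (a ^+ 6 * b ^+ 9).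
Proof.
move=> a0 b0 ab0; apply: eqmod_eq => m.
have ab90 (c d : {fps R}) : c * d = (a * b) ^+ 9 -> fcoef (c * d) 0 = 0.
  by move=> ->; apply: (eqmodX0 (k := 9)).
apply: (@eqmod_trans _ _ (theta_sum a b (3 * m).+1)).
  by apply: (@eqmod_le _ _ (3 * m).+1); [lia|apply: jacobi_triple_product].
rewrite theta_sum3; apply: eqmod_sym.
do ![apply: eqmodD || apply: eqmodM] => //; apply: jacobi_triple_product;
  rewrite ?mulf_neq0 ?expf_neq0 // ab90 //; ring.
Qed.

End JacobiTripleProduct.

(** * Theta functions as eta quotients *)

Section QPochhammer.
Variable R : comNzRingType.
Implicit Types a q : {fps R}.

Lemma qpoch_split r a q : (0 < r)%N -> fcoef q 0 = 0 ->
  qpoch a q = \prod_(i < r) qpoch (a * q ^+ i) (q ^+ r).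
Proof.
move=> r0 q0; apply: eqmod_eq => n.
have q0r : fcoef (q ^+ r) 0 = 0 by apply: (eqmodX0 q0).
apply: (@eqmod_trans _ _ (\prod_(j < r * n) (1 - a * q ^+ j))).
  by apply: (@eqmod_le _ _ (r * n)); [rewrite leq_pmull|apply: eqmod_qpoch].
have -> : \prod_(j < r * n) (1 - a * q ^+ j) =
    \prod_(i < r) \prod_(j < n) (1 - a * q ^+ i * (q ^+ r) ^+ j).
  elim: n => [|n IH].
    by rewrite muln0 big_ord0 big1 // => i _; rewrite big_ord0.
  under [RHS]eq_bigr do rewrite big_ord_recr /=.
  rewrite big_split -IH mulnS addnC big_split_ord /=; congr (_ * _).
  by apply: eq_bigr => i _; rewrite -mulrA -exprM -exprD addnC.
apply: (big_ind2 (fun f g => eqmod n f g)) => // [f f' g g'|i _]; first exact: eqmodM.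
exact/eqmod_sym/eqmod_qpoch.
Qed.

Lemma qpochS a q : fcoef q 0 = 0 -> qpoch a q = (1 - a) * qpoch (a * q) q.
Proof.
move=> q0; apply: eqmod_eq => n.
apply: (@eqmod_trans _ _ (\prod_(j < n.+1) (1 - a * q ^+ j))).
  by apply: (@eqmod_le _ _ n.+1) => //; apply: eqmod_qpoch.
rewrite big_ord_recl /= mulr1; apply: eqmodM => //.
under eq_bigr do rewrite /bump /= add1n exprS mulrA.
exact/eqmod_sym/eqmod_qpoch.
Qed.

Lemma qpochN a q : fcoef q 0 = 0 ->
  qpoch a q * qpoch (- a) q = qpoch (a ^+ 2) (q ^+ 2).
Proof.
move=> q0; apply: eqmod_eq => n.
apply: eqmod_trans (eqmodM (eqmod_qpoch _ q0) (eqmod_qpoch _ q0)) _.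
apply/eqmod_sym; apply: eqmod_trans (eqmod_qpoch _ _) _.
  exact: (eqmodX0 q0 (k := 2)).
rewrite -big_split /= (eq_bigr (fun j : 'I_n => (1 - a * q ^+ j) * (1 - - a * q ^+ j))) //.
by move=> j _; rewrite exprAC; ring.
Qed.

Lemma jacobiC a q : jacobi a q = jacobi q a :> {fps R}.
Proof. by rewrite /jacobi (mulrC q a); ring. Qed.

Let X k : {fps R} := fpsX ^+ k.

Let qpoch_euler r k : (0 < r)%N -> (0 < k)%N ->
  euler k = \prod_(i < r) qpoch (X (i.+1 * k)) (X (r * k)) :> {fps R}.
Proof.
move=> r0 k0; rewrite /euler (qpoch_split _ r0) ?fcoefXn0 //.
by apply: eq_bigr => i _; rewrite -!exprM -exprD mulSn (mulnC k) (mulnC k).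
Qed.

Let qpochN_euler k : (0 < k)%N ->
  qpoch (- X k) (X k) * euler k = euler (2 * k) :> {fps R}.
Proof.
by move=> k0; rewrite mulrC /euler qpochN ?fcoefXn0 // -!exprM mulnC.
Qed.

Lemma jacobi_phi k : (0 < k)%N ->
  jacobi (- X k) (- X k) * euler (2 * k) = euler k ^+ 2.
Proof.
move=> k0; rewrite (qpoch_euler (isT : (0 < 2)%N) k0) !big_ord_recr big_ord0 /=.
rewrite /jacobi opprK mulrNN -exprD addnn -mul2n mul1n mul1r /euler -/(X (2 * k)).
by ring.
Qed.

(** At [k = 1] this is [f(1, q) = 2 psi(q)] with [psi(q) = f_2^2 / f_1]; the 2 is the first factor
    of [(-1; q)_oo]. *)
Lemma jacobi_psi k : (0 < k)%N ->
  jacobi 1 (X k) * euler k = 2%:R * euler (2 * k) ^+ 2.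
Proof.
move=> k0; rewrite -(qpochN_euler k0) /jacobi mul1r (qpochS (-1)) ?fcoefXn0 // mulN1r.
by rewrite -[qpoch (X k) (X k)]/(euler k); ring.
Qed.

(** [euler k] is split into residue classes modulo 6: the classes 2, 4, 6 make up [euler (2 * k)],
    the classes 3, 6 make up [euler (3 * k)], and 1, 5 remain for [jacobi]. *)
Lemma jacobi_1_5 k : (0 < k)%N ->
  jacobi (- X k) (- X (5 * k)) * euler (2 * k) * euler (3 * k) =
  euler k * euler (6 * k) ^+ 2.
Proof.
move=> k0; rewrite (@qpoch_euler 6 k) // (@qpoch_euler 3 (2 * k)) ?muln_gt0 //.
rewrite (@qpoch_euler 2 (3 * k)) ?muln_gt0 // !big_ord_recr !big_ord0 /=.
rewrite /jacobi !opprK mulrNN -exprD !mulnA /= !mul1n -mulSn -/(X (6 * k)).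
by rewrite /euler -/(X (6 * k)); ring.
Qed.

Lemma jacobi_1_2 k : (0 < k)%N ->
  jacobi (X k) (X (2 * k)) * euler k * euler (6 * k) =
  euler (2 * k) * euler (3 * k) ^+ 2.
Proof.
move=> k0; rewrite -(qpochN_euler k0) (_ : 6 * k = 2 * (3 * k))%N; last by lia.
have -> : qpoch (- X k) (X k) = qpoch (- X k) (X (3 * k)) *
    qpoch (- X (2 * k)) (X (3 * k)) * qpoch (- X (3 * k)) (X (3 * k)).
  rewrite (@qpoch_split 3) ?fcoefXn0 // !big_ord_recr big_ord0 /= !mulNr.
  rewrite /X -!exprM -!exprD mul1r !(mulnC k).
  by do ![congr (_ * _) || congr (qpoch (- _ ^+ _))]; lia.
rewrite -qpochN_euler ?muln_gt0 // /jacobi -exprD -mulSn -/(X (3 * k)).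
by rewrite -[qpoch (X (3 * k)) _]/(euler (3 * k)); ring.
Qed.

End QPochhammer.

(** * Eta quotients of level 18 *)

(* Otherwise unification would compute coefficients of these series. *)
Opaque euler qpoch jacobi.

Lemma fpsX_neq0 : (fpsX : {fps rat}) != 0.
Proof. by apply/eqP => /fpsP /(_ 1%N) /eqP; rewrite /= oner_eq0. Qed.

Lemma euler_neq0 k : (0 < k)%N -> (euler k : {fps rat}) != 0.
Proof. by move=> k0; apply: contraTneq (euler_unit rat k0) => ->; rewrite unitr0. Qed.

Local Notation e := (@euler rat).

Definition tau : {fps rat} := e 1 * e 6 ^+ 3 / (e 2 * e 3 ^+ 3).
Definition tser : {fps rat} := fpsX * fps_cube tau.
Definition user : {fps rat} := fpsX * tau ^+ 3.

Lemma tser_cube : tser ^+ 3 = fps_cube user.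
Proof.
by rewrite /tser /user; move: tau => f; rewrite exprMn rmorphM rmorphXn /= fps_cubeX.
Qed.

Lemma cube_unit (f : {fps rat}) :
  (fps_cube f \is a GRing.unit) = (f \is a GRing.unit).
Proof. by rewrite !fps_unitE fcoef_cube0. Qed.

Lemma tauE : tau * (e 2 * e 3 ^+ 3) = e 1 * e 6 ^+ 3.
Proof. by apply: divrK; rewrite unitrM unitrX euler_unit. Qed.

Local Definition cube_e1 : fps_cube (e 1) = e 3 := @cube_euler rat 1 isT.
Local Definition cube_e2 : fps_cube (e 2) = e 6 := @cube_euler rat 2 isT.
Local Definition cube_e3 : fps_cube (e 3) = e 9 := @cube_euler rat 3 isT.
Local Definition cube_e6 : fps_cube (e 6) = e 18 := @cube_euler rat 6 isT.

Lemma tserE : tser * (e 6 * e 9 ^+ 3) = fpsX * (e 3 * e 18 ^+ 3).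
Proof.
rewrite -[e 3]cube_e1 -[e 9]cube_e3 -[e 18]cube_e6 -[in LHS]cube_e2 /tser.
move: tauE; move: tau (e 1) (e 2) (e 3) (e 6) => f a b c d fE.
rewrite -mulrA -!rmorphXn -!rmorphM /=; congr (_ * fps_cube _).
by rewrite fE.
Qed.

(** For [a = b] the classes 1 and -1 modulo 3 coincide, by the symmetry of [jacobi]; for [a = 1], as
    in [jacobi_dissection_psi], the classes 0 and 1 do. *)
Lemma jacobi_dissection_phi (q : {fps rat}) : q != 0 -> fcoef q 0 = 0 ->
  jacobi (- q) (- q) =
    jacobi (- q ^+ 9) (- q ^+ 9) - 2%:R * q * jacobi (- q ^+ 3) (- q ^+ 15).
Proof.
move=> q_neq0 q0; rewrite jacobi_dissection ?oppr_eq0 ?fcoefM0 ?fcoefN ?q0 ?oppr0 ?mulr0 //.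
have -> : (- q) ^+ 6 * (- q) ^+ 3 = - q ^+ 9 by ring.
have -> : (- q) ^+ 3 * (- q) ^+ 6 = - q ^+ 9 by ring.
have -> : (- q) ^+ 9 * (- q) ^+ 6 = - q ^+ 15 by ring.
have -> : (- q) ^+ 6 * (- q) ^+ 9 = - q ^+ 15 by ring.
have -> : (- q) ^+ 3 = - q ^+ 3 by ring.
have aux (a b c x : {fps rat}) : c = b -> a + - x * c + - x * b = a - 2%:R * x * b.
  by move=> ->; ring.
by apply: aux; apply: jacobiC.
Qed.

Lemma jacobi_dissection_psi (q : {fps rat}) : q != 0 -> fcoef q 0 = 0 ->
  jacobi 1 q = 2%:R * jacobi (q ^+ 3) (q ^+ 6) + q * jacobi 1 (q ^+ 9).
Proof.
move=> q_neq0 q0; rewrite (jacobi_dissection (oner_neq0 _) q_neq0); last by rewrite mul1r.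
have aux (a b c : {fps rat}) : b = a -> a + b + c = 2%:R * a + c by move=> ->; ring.
by rewrite !expr1n !mul1r; apply: aux; apply: jacobiC.
Qed.

Local Lemma fcoefX0 : fcoef (fpsX : {fps rat}) 0 = 0. Proof. by []. Qed.

(** [jacobi_1_5] gives [f(-q^3, -q^15) = f_3 f_18^2 / (f_6 f_9)], so that
    [q f(-q^3, -q^15) = t phi(-q^9)], where [phi(-q) = f_1^2 / f_2]. *)
Lemma phi_dissection : e 1 ^+ 2 * e 18 = e 9 ^+ 2 * e 2 * (1 - 2%:R * tser).
Proof.
move: (jacobi_dissection_phi fpsX_neq0 fcoefX0) (@jacobi_phi rat 1 isT)
  (@jacobi_phi rat 9 isT) (@jacobi_1_5 rat 3 isT) tserE.
rewrite expr1 !muln1 -[(2 * 9)%N]/18%N -[(5 * 3)%N]/15%N -[(2 * 3)%N]/6%N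
  -[(3 * 3)%N]/9%N -[(6 * 3)%N]/18%N.
have := mulf_neq0 (euler_neq0 (isT : 0 < 6)%N) (euler_neq0 (isT : 0 < 9)%N).
move: (jacobi (- fpsX) _) (jacobi (- fpsX ^+ 9) _) (jacobi (- fpsX ^+ 3) _).
move: (e 1) (e 2) (e 3) (e 6) (e 9) (e 18) tser => e1 e2 e3 e6 e9 e18 t a b c.
move=> nz aE aE1 bE cE tE.
apply: (mulfI nz).
transitivity (a * e2 * e18 * (e6 * e9)); first by rewrite aE1; ring.
transitivity ((b * e18) * e2 * (e6 * e9) - 2%:R * e2 * fpsX * e18 * (c * e6 * e9)).
  by rewrite aE; ring.
rewrite bE cE; transitivity (e6 * e9 * e9 ^+ 2 * e2 - 2%:R * e2 * (t * (e6 * e9 ^+ 3))).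
  by rewrite tE; ring.
by ring.
Qed.

(** Here [q psi(q^9) = t f(q^3, q^6)], with [f(q^3, q^6) = f_6 f_9^2 / (f_3 f_18)] from
    [jacobi_1_2]. *)
Lemma psi_dissection :
  e 2 ^+ 2 * e 3 * e 18 = e 1 * e 6 * e 9 ^+ 2 * (1 + tser).
Proof.
move: (jacobi_dissection_psi fpsX_neq0 fcoefX0) (@jacobi_psi rat 1 isT)
  (@jacobi_psi rat 9 isT) (@jacobi_1_2 rat 3 isT) tserE.
rewrite expr1 !muln1 -[(2 * 9)%N]/18%N -[(2 * 3)%N]/6%N
  -[(3 * 3)%N]/9%N -[(6 * 3)%N]/18%N.
have := fps_natr_unit (isT : 0 < 2)%N.
have := mulf_neq0 (euler_neq0 (isT : 0 < 6)%N) (expf_neq0 2 (euler_neq0 (isT : 0 < 9)%N)).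
move: (jacobi 1 _) (jacobi 1 fpsX) (jacobi (fpsX ^+ 3) _).
move: (e 1) (e 2) (e 3) (e 6) (e 9) (e 18) tser => e1 e2 e3 e6 e9 e18 t b a c.
move=> nz U2 aE aE1 bE cE tE.
apply: (mulrI U2); apply: (mulfI nz).
transitivity (a * e1 * e3 * e18 * (e6 * e9 ^+ 2)); first by rewrite aE1; ring.
transitivity (2%:R * (c * e3 * e18) * e1 * (e6 * e9 ^+ 2)
  + fpsX * (b * e9) * e1 * e3 * e18 * e6 * e9); first by rewrite aE; ring.
rewrite bE cE; transitivity (2%:R * e1 * e6 ^+ 2 * e9 ^+ 4
  + 2%:R * e1 * e6 * e9 * (fpsX * (e3 * e18 ^+ 3))); first by ring.
by rewrite -tE; ring.
Qed.

Local Definition norm_e1 : norm3 (e 1) * e 3 = e 1 ^+ 4 := @norm3_euler rat 1 isT.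
Local Definition norm_e2 : norm3 (e 2) * e 6 = e 2 ^+ 4 := @norm3_euler rat 2 isT.
Local Definition nz k (k0 : (0 < k)%N) : e k != 0 := euler_neq0 k0.

Lemma norm3_1pt (c : {fps rat}) : norm3 (1 + fps_cube c * tser) = 1 + c ^+ 3 * user.
Proof.
rewrite /tser /user; move: tau => f.
have -> : 1 + fps_cube c * (fpsX * fps_cube f) = 1 + fpsX * fps_cube (c * f).
  by rewrite rmorphM /=; ring.
by rewrite norm3_1pX; ring.
Qed.

(** Take norms in [phi_dissection]: [f_1] and [f_2] have norms [f_1^4 / f_3] and [f_2^4 / f_6],
    while the series [f_9] and [f_18] in [q^3] become [f_3^3] and [f_6^3]. *)
Lemma phi_norm : e 1 ^+ 8 * e 6 ^+ 4 = e 3 ^+ 8 * e 2 ^+ 4 * (1 - 8%:R * user).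
Proof.
have := norm3_1pt (- 2%:R); rewrite rmorphN rmorphMn rmorph1 mulNr.
move: phi_dissection norm_e1 norm_e2; rewrite -cube_e6 -cube_e3.
move: (e 1) (e 2) (e 3) (e 6) user => e1 e2 e3 e6 u.
move: (1 - 2%:R * tser) => g /(congr1 (@norm3 rat)) + + + gE.
rewrite !expr2 !norm3M !norm3_cube gE; move: (norm3 e1) (norm3 e2) => n1 n2 E nE1 nE2.
transitivity ((n1 * e3) ^+ 2 * e6 ^+ 3 * e6); first by rewrite nE1; ring.
transitivity (e3 ^+ 2 * e6 * (n1 * n1 * e6 ^+ 3)); first by ring.
by rewrite E -nE2; ring.
Qed.

Lemma psi_norm : e 2 ^+ 5 * e 6 = e 1 * e 3 ^+ 5 * (1 + user).
Proof.
have := norm3_1pt 1; rewrite rmorph1 mul1r expr1n mul1r.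
have := mulf_neq0 (mulf_neq0 (expf_neq0 3 (nz (isT : 0 < 1)%N)) (expf_neq0 3 (nz (isT : 0 < 2)%N)))
  (mulf_neq0 (nz (isT : 0 < 3)%N) (expf_neq0 2 (nz (isT : 0 < 6)%N))).
move: psi_dissection norm_e1 norm_e2; rewrite -cube_e6 -cube_e3.
rewrite -[X in _ * X * _ = _]cube_e1 -[X in _ = _ * X * _ * _]cube_e2.
move: (e 1) (e 2) (e 3) (e 6) user => e1 e2 e3 e6 u.
move: (1 + tser) => g /(congr1 (@norm3 rat)) + + + nz0 gE.
rewrite !expr2 !norm3M !norm3_cube gE; move: (norm3 e1) (norm3 e2) => n1 n2 E nE1 nE2.
apply: (mulfI nz0).
transitivity ((n2 * e6) ^+ 2 * e1 ^+ 3 * e3 * e6 ^+ 3); first by rewrite nE2; ring.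
transitivity (e3 * e6 ^+ 2 * (n2 * n2 * e1 ^+ 3 * e6 ^+ 3)); first by ring.
rewrite E; transitivity ((n1 * e3) * e2 ^+ 3 * e6 ^+ 2 * (e3 ^+ 3 * e3 ^+ 3) * (1 + u)).
  by ring.
by rewrite nE1; ring.
Qed.

Lemma xserE : xser * (e 1 ^+ 5 * e 3) = fpsX * (e 2 * e 6 ^+ 5).
Proof.
rewrite /xser -[LHS]mulrA; congr (_ * _); apply: divrK.
by rewrite unitrM unitrX euler_unit.
Qed.

(** Read at [q^3], this is [x(q^3) = t^3 / (1 - 8 t^3)], the source of the cubic equation of [w]. *)
Lemma xser_user : xser * (1 - 8%:R * user) = user.
Proof.
have uE : user * (e 2 ^+ 3 * e 3 ^+ 9) = fpsX * (e 1 ^+ 3 * e 6 ^+ 9).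
  move: tauE; rewrite /user; move: tau (e 1) (e 2) (e 3) (e 6) => f e1 e2 e3 e6 fE.
  transitivity (fpsX * (f * (e2 * e3 ^+ 3)) ^+ 3); first by ring.
  by rewrite fE; ring.
have := mulf_neq0 (mulf_neq0 (expf_neq0 5 (nz (isT : 0 < 1)%N)) (expf_neq0 4 (nz (isT : 0 < 2)%N)))
  (expf_neq0 9 (nz (isT : 0 < 3)%N)).
move: uE xserE phi_norm.
move: (e 1) (e 2) (e 3) (e 6) user xser => e1 e2 e3 e6 u x uE xE E nz0.
apply: (mulIf nz0).
transitivity (x * (e1 ^+ 5 * e3) * (e3 ^+ 8 * e2 ^+ 4 * (1 - 8%:R * u))); first by ring.
rewrite xE -E; transitivity (fpsX * (e1 ^+ 3 * e6 ^+ 9) * e1 ^+ 5 * e2); first by ring.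
by rewrite -uE; ring.
Qed.

Definition wser : {fps rat} := tser / (1 - 2%:R * tser).

Lemma tser0 : fcoef tser 0 = 0.
Proof. by rewrite /tser; move: tau => f; rewrite fcoefXM. Qed.

Lemma fps_unit1pM (f g : {fps rat}) : fcoef f 0 = 0 -> 1 + g * f \is a GRing.unit.
Proof. by move=> f0; rewrite fps_unitE fcoefD fcoefM0 f0 mulr0 addr0 unitr1. Qed.

Local Lemma P_unit : 1 - 2%:R * tser \is a GRing.unit.
Proof. by rewrite -mulNr; apply: fps_unit1pM tser0. Qed.

Local Lemma wP : (1 - 2%:R * tser) * wser = tser.
Proof. by rewrite /wser mulrC (divrK P_unit). Qed.

Local Lemma Pinv : (1 - 2%:R * tser) * (1 + 2%:R * wser) = 1.
Proof.
by move: wP; move: wser tser => w t wE; rewrite mulrDr mulrCA wE; ring.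
Qed.

(** All factors are eta quotients, by [phi_dissection], [psi_dissection] and, for [1 + t^3],
    [psi_norm] read at [q^3]. *)
Lemma xser_tser :
  xser * (1 - 2%:R * tser) ^+ 3 * (1 + tser) = tser * (1 + tser ^+ 3).
Proof.
have TE : e 6 ^+ 5 * e 18 = e 3 * e 9 ^+ 5 * (1 + tser ^+ 3).
  move: psi_norm cube_e1 cube_e2 cube_e3 cube_e6 tser_cube.
  move: (e 1) (e 2) (e 3) (e 6) (e 9) (e 18) user (tser ^+ 3).
  move=> e1 e2 e3 e6 e9 e18 u t3 E c1 c2 c3 c6 t3E.
  have : fps_cube e2 ^+ 5 * fps_cube e6 = fps_cube e1 * fps_cube e3 ^+ 5 * (1 + fps_cube u).
    by rewrite -!rmorphXn -[1](rmorph1 (@fps_cube rat)) -rmorphD -!rmorphM /= E.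
  by rewrite c1 c2 c3 c6 -t3E.
have M : e 1 * e 2 * e 3 * e 6 * e 9 != 0 by rewrite !mulf_neq0 // nz.
move: xserE tserE phi_dissection psi_dissection TE.
move: tser (1 - 2%:R * tser) (1 + tser) (1 + tser ^+ 3) => t P S T.
move: (e 1) (e 2) (e 3) (e 6) (e 9) (e 18) xser M => e1 e2 e3 e6 e9 e18 x M xE tE PE SE TE.
(* A power of [M] large enough to absorb all denominators. *)
have nz0 := expf_neq0 16 M.
apply: (mulIf nz0).
transitivity (x * (e1 ^+ 5 * e3) * (e9 ^+ 2 * e2 * P) ^+ 3 * (e1 * e6 * e9 ^+ 2 * S) *
   (e1 ^+ 10 * e2 ^+ 13 * e3 ^+ 15 * e6 ^+ 15 * e9 ^+ 8)); first by ring.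
rewrite xE -PE -SE.
transitivity ((fpsX * (e3 * e18 ^+ 3)) * (e6 ^+ 5 * e18) *
   (e1 ^+ 16 * e2 ^+ 16 * e3 ^+ 15 * e6 ^+ 15 * e9 ^+ 8)); first by ring.
by rewrite -tE TE; ring.
Qed.

(** Cancelling [1 + t] leaves [x (1 - 2 t)^3 = t (1 - t + t^2)]. As [1 + 2 w] is inverse to
    [1 - 2 t] and [t (1 + 2 w) = w], multiplying by [(1 + 2 w)^3] replaces [t] by [w]. *)
Lemma xser_wser : xser = wser + 3%:R * wser ^+ 2 + 3%:R * wser ^+ 3.
Proof.
have SU : 1 + tser \is a GRing.unit by rewrite -[tser]mul1r fps_unit1pM ?tser0.
move: xser_tser SU wP Pinv; move: xser tser wser => x t w.
set P := 1 - 2%:R * t => xE SU wE PE.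
have {}xE : x * P ^+ 3 = t * (1 - t + t ^+ 2).
  by apply: (mulIr SU); rewrite xE; ring.
transitivity (x * P ^+ 3 * (1 + 2%:R * w) ^+ 3).
  by rewrite -mulrA -exprMn PE; ring.
rewrite xE; transitivity ((t * (1 + 2%:R * w)) * ((1 + 2%:R * w) ^+ 2
   - (t * (1 + 2%:R * w)) * (1 + 2%:R * w) + (t * (1 + 2%:R * w)) ^+ 2)); first by ring.
have -> : t * (1 + 2%:R * w) = w by rewrite -[in LHS]wE mulrAC PE mul1r.
by ring.
Qed.

Lemma cube_1Bn n (f : {fps rat}) : fps_cube (1 - n%:R * f) = 1 - n%:R * fps_cube f.
Proof. by rewrite rmorphB rmorph1 rmorphM rmorph_nat. Qed.

Lemma wser_cubic :
  wser ^+ 3 = fps_cube xser * (12%:R * wser ^+ 2 + 6%:R * wser + 1).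
Proof.
have : fps_cube xser * (1 - 8%:R * tser ^+ 3) = tser ^+ 3.
  rewrite tser_cube -cube_1Bn; move: xser_user; move: xser user => x u E.
  by rewrite -rmorphM /= E.
move: wP Pinv; move: (fps_cube xser) tser wser => x3 t w.
set P := 1 - 2%:R * t => wE PE xE.
have tw : t * (1 + 2%:R * w) = w by rewrite -[in LHS]wE mulrAC PE mul1r.
rewrite -{1}tw exprMn -xE.
transitivity (x3 * ((1 + 2%:R * w) ^+ 3 - 8%:R * (t * (1 + 2%:R * w)) ^+ 3)); first by ring.
by rewrite tw; ring.
Qed.

(** * The traces of [w] and [w^2] *)

Local Notation U3 := (@part3 rat 0).

Lemma U3_cube (f g : {fps rat}) : U3 (fps_cube f * g) = f * U3 g.
Proof. exact: part3_cubeM. Qed.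

Local Lemma U3_tser : U3 tser = 0.
Proof. by rewrite /tser; move: tau => f; rewrite part3_XM0 part3_cube0 ?mulr0. Qed.

Local Lemma U3_tser2 : U3 (tser ^+ 2) = 0.
Proof.
rewrite /tser; move: tau => f.
by rewrite exprMn expr2 -mulrA part3_XM0 part3_XM -rmorphXn part3_cube0 ?mulr0.
Qed.

Local Lemma user_unit : 1 - 8%:R * user \is a GRing.unit.
Proof.
rewrite -mulNr; apply: fps_unit1pM.
by rewrite /user; move: tau => f; rewrite fcoefXM.
Qed.

(** The denominator [1 - 2 t] is rationalised to [1 - 8 t^3], a series in [q^3], which [U3_cube]
    moves out of [U_3]; then only powers of [t^3] contribute to the traces. *)
Local Lemma wt : fps_cube (1 - 8%:R * user) * wser = tser * (1 + 2%:R * tser + 4%:R * tser ^+ 2).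
Proof.
rewrite cube_1Bn -tser_cube; move: wP; move: tser wser => t w wE.
transitivity ((1 - 2%:R * t) * w * (1 + 2%:R * t + 4%:R * t ^+ 2)); first by ring.
by rewrite wE.
Qed.

Lemma U3_wser : U3 wser = 4%:R * xser.
Proof.
apply: (mulrI user_unit); rewrite -U3_cube wt.
have -> : tser * (1 + 2%:R * tser + 4%:R * tser ^+ 2) =
  tser + fps_cube 2%:R * tser ^+ 2 + fps_cube (4%:R * user).
  by rewrite rmorphM !rmorph_nat /= -tser_cube; ring.
rewrite !part3D U3_cube U3_tser U3_tser2 part3_cube.
by move: xser_user; move: xser user => x u {1}<-; ring.
Qed.

Lemma U3_wser2 : U3 (wser ^+ 2) = 4%:R * xser + 48%:R * xser ^+ 2.
Proof.
apply: (mulrI user_unit); apply: (mulrI user_unit).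
rewrite -!U3_cube.
have -> : fps_cube (1 - 8%:R * user) * (fps_cube (1 - 8%:R * user) * wser ^+ 2) =
  tser ^+ 2 + fps_cube (12%:R * user) * tser + fps_cube (16%:R * user) * tser ^+ 2 +
  fps_cube (4%:R * user + 16%:R * user * user).
  have -> (a b : {fps rat}) : a * (a * b ^+ 2) = (a * b) ^+ 2 by ring.
  rewrite wt; move: tser_cube; move: user tser => u t tE.
  rewrite rmorphD !rmorphM !rmorph_nat /= -tE.
  by ring.
rewrite !part3D !U3_cube U3_tser U3_tser2 part3_cube !mulr0 !add0r.
move: xser_user; move: xser user => x u xu.
transitivity (4%:R * (x * (1 - 8%:R * u)) * (1 - 8%:R * u)
  + 48%:R * (x * (1 - 8%:R * u)) ^+ 2); first by rewrite xu; ring.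
by ring.
Qed.

(* [q D(q) / D(q^9)], where [D] is the generating function of [d2]. *)
Definition Aser : {fps rat} :=
  fpsX * (e 2 ^+ 2 / e 1 ^+ 7) / fps_cube (fps_cube (e 2 ^+ 2 / e 1 ^+ 7)).

(** [A (1 - 2 t)^4 (1 + t) = t] is an identity of eta quotients; it is multiplied by
    [(1 + 2 w)^5]. *)
Lemma Aser_wser : Aser * (1 + 3%:R * wser) = wser * (1 + 2%:R * wser) ^+ 4.
Proof.
have AE : Aser * (e 1 ^+ 7 * e 18 ^+ 2) = fpsX * (e 2 ^+ 2 * e 9 ^+ 7).
  have DU : e 2 ^+ 2 / e 1 ^+ 7 \is a GRing.unit.
    by rewrite unitrM unitrV !unitrX ?euler_unit.
  have DE : e 2 ^+ 2 / e 1 ^+ 7 * e 1 ^+ 7 = e 2 ^+ 2.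
    by apply: divrK; rewrite unitrX ?euler_unit.
  move: cube_e1 cube_e2 cube_e3 cube_e6 DU DE; rewrite /Aser.
  move: (e 2 ^+ 2 / e 1 ^+ 7) => D.
  move: (e 1) (e 2) (e 3) (e 6) (e 9) (e 18) => e1 e2 e3 e6 e9 e18 c1 c2 c3 c6 DU DE.
  have C9 : fps_cube (fps_cube D) * e9 ^+ 7 = e18 ^+ 2.
    by rewrite -c3 -c1 -c6 -c2 -!rmorphXn -!rmorphM /= DE.
  rewrite -C9 -DE; set C := fps_cube _.
  have CU : C \is a GRing.unit by rewrite !cube_unit.
  transitivity (fpsX * D / C * C * e1 ^+ 7 * e9 ^+ 7); first by ring.
  by rewrite divrK //; ring.
have M : e 1 * e 2 * e 3 * e 6 * e 9 * e 18 != 0 by rewrite !mulf_neq0 // nz.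
have AT : Aser * (1 - 2%:R * tser) ^+ 4 * (1 + tser) = tser.
  move: AE M tserE phi_dissection psi_dissection.
  move: tser (1 - 2%:R * tser) (1 + tser) Aser => t P S A.
  move: (e 1) (e 2) (e 3) (e 6) (e 9) (e 18) => e1 e2 e3 e6 e9 e18 AE M tE PE SE.
  apply: (mulIf (expf_neq0 11 M)).
  transitivity (A * (e1 ^+ 7 * e18 ^+ 2) * (e9 ^+ 2 * e2 * P) ^+ 4 * (e1 * e6 * e9 ^+ 2 * S) *
    (e1 ^+ 3 * e2 ^+ 7 * e3 ^+ 11 * e6 ^+ 10 * e9 * e18 ^+ 9)); first by ring.
  rewrite AE -PE -SE.
  transitivity (fpsX * (e3 * e18 ^+ 3) *
    (e1 ^+ 11 * e2 ^+ 11 * e3 ^+ 11 * e6 ^+ 10 * e9 ^+ 8 * e18 ^+ 11)); first by ring.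
  by rewrite -tE; ring.
move: AT wP Pinv; move: Aser tser wser => A t w; set P := 1 - 2%:R * t => AT wE PE.
have tw : t * (1 + 2%:R * w) = w by rewrite -[in LHS]wE mulrAC PE mul1r.
transitivity (A * P ^+ 4 * (1 + t) * (1 + 2%:R * w) ^+ 5).
  transitivity (A * (P * (1 + 2%:R * w)) ^+ 4 * (1 + 2%:R * w + t * (1 + 2%:R * w))).
    by rewrite PE tw; ring.
  by ring.
by rewrite AT -{2}tw; ring.
Qed.

(** * The recursion satisfied by [L] *)

(* The inverse of the generating function of [d2]. *)
Local Definition G := e 1 ^+ 7 / e 2 ^+ 2.

Local Lemma G_unit : G \is a GRing.unit.
Proof. by rewrite unitrM unitrV !unitrX ?euler_unit. Qed.

Local Lemma GV : e 2 ^+ 2 / e 1 ^+ 7 = G^-1.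
Proof.
rewrite /G; move: (euler_unit rat (isT : (0 < 1)%N)) (euler_unit rat (isT : (0 < 2)%N)).
move: (e 1) (e 2) => e1 e2 U1 U2; rewrite [RHS]invrM; first by rewrite invrK.
  exact: unitrX.
by rewrite unitrV; apply: unitrX.
Qed.

Local Lemma cube_G : fps_cube G = e 3 ^+ 7 / e 6 ^+ 2.
Proof.
rewrite -cube_e1 -cube_e2 /G; move: (euler_unit rat (isT : (0 < 2)%N)).
move: (e 1) (e 2) => e1 e2 U.
by rewrite -!rmorphXn -rmorphV ?unitrX // -rmorphM.
Qed.

Lemma AserE : Aser = fpsX * fps_cube (fps_cube G) / G.
Proof.
rewrite /Aser GV; move: G G_unit => g U.
by rewrite !rmorphV ?cube_unit //= invrK mulrAC.
Qed.

(** The coefficient of [q^(3n+3)] has inner index [3 n + 2], and [lambda] grows by [2 * 3^(2k+1)].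
    In [d2_section_odd] the extra [q] makes this index [3 n + 1], and [lambda] grows by
    [3^(2k+2)]. *)
Lemma d2_section_even k : d2_section (2 * k).+2 = U3 (d2_section (2 * k).+1).
Proof.
apply/fpsP => n; rewrite fcoef_part3 addn0 !fcoefXM; case: n => [|n] //.
rewrite (mulnS 3) /=; congr d2.
have := lambda_exact (2 * k).+1; have := lambda_exact (2 * k).+2.
rewrite /= oddM /= !expnS; move: (lambda _) (lambda _) (3 ^ _)%N => a b c; nia.
Qed.

Lemma d2_section_odd k :
  d2_section (2 * k).+3 = U3 (fpsX * d2_section (2 * k).+2).
Proof.
apply/fpsP => n; rewrite fcoef_part3 addn0; case: n => [|n].
  by rewrite muln0 !fcoefXM.
rewrite (mulnS 3) -[(3 + _)%N]/(3 * n).+3 /d2_section !fcoefXM /=; congr d2.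
have := lambda_exact (2 * k).+3; have := lambda_exact (2 * k).+2.
rewrite /= oddM /= !expnS; move: (lambda _) (lambda _) (3 ^ _)%N => a b c; nia.
Qed.

Lemma d2_section1 : d2_section 1 = U3 (fpsX * G^-1).
Proof.
apply/fpsP => n; rewrite fcoef_part3 addn0; case: n => [|n].
  by rewrite muln0 !fcoefXM.
by rewrite (mulnS 3) !fcoefXM -GV /= addnC.
Qed.

Lemma L_oddE a : odd a -> L a = fps_cube G * d2_section a.
Proof. by rewrite /L cube_G => ->. Qed.

Lemma L_evenE a : ~~ odd a -> L a = G * d2_section a.
Proof. by rewrite /L => /negbTE ->. Qed.

Lemma L1 : L 1 = U3 Aser.
Proof.
rewrite L_oddE // d2_section1 -U3_cube; congr part3.
by rewrite AserE; move: G => g; ring.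
Qed.

Lemma L_even k : L (2 * k).+2 = U3 (L (2 * k).+1).
Proof.
rewrite L_evenE /= ?oddM // L_oddE /= ?oddM // U3_cube.
by rewrite d2_section_even.
Qed.

(** The outer [G(q^3)] enters [U_3] as [G(q^9)], and [q G(q^9) = A G]. *)
Lemma L_odd k : L (2 * k).+3 = U3 (Aser * L (2 * k).+2).
Proof.
rewrite L_oddE /= ?oddM // L_evenE /= ?oddM // d2_section_odd -U3_cube AserE.
congr part3; move: (d2_section _) G G_unit => s g U.
transitivity (fpsX * fps_cube (fps_cube g) * s * (g / g)); last by ring.
by rewrite divrr //; ring.
Qed.

(** * Lattices of polynomials in [x] *)

Section ListPolynomials.
Variable K : comNzRingType.
Implicit Types (s t : seq Z) (y : K).

Local Arguments Z.mul : simpl never.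

(** Coefficients have type [Z] so that the finite verifications run in [vm_compute]; lists start
    with the constant term. *)
Definition zr (c : Z) : K := (int_of_Z c)%:~R.

Lemma zrD c d : zr (Z.add c d) = zr c + zr d.
Proof. by rewrite /zr -intrD -rmorphD. Qed.

Lemma zrM c d : zr (Z.mul c d) = zr c * zr d.
Proof. by rewrite /zr -intrM -rmorphM. Qed.

Fixpoint peval s y : K := if s is c :: s' then zr c + y * peval s' y else 0.

Fixpoint padd s t : seq Z :=
  match s, t with
  | c :: s', d :: t' => Z.add c d :: padd s' t'
  | [::], _ => t
  | _, [::] => s
  end.

Definition pscale (c : Z) s : seq Z := map (Z.mul c) s.

Fixpoint pmul s t : seq Z :=
  if s is c :: s' then padd (pscale c t) (Z0 :: pmul s' t) else [::].

Definition pexp s (n : nat) : seq Z := ssrnat.iter n (pmul s) [:: Zpos 1].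

Lemma peval_add s t y : peval (padd s t) y = peval s y + peval t y.
Proof.
elim: s t => [|c s IH] [|d t] /=; rewrite ?add0r ?addr0 //.
by rewrite IH zrD; ring.
Qed.

Lemma peval_scale c s y : peval (pscale c s) y = zr c * peval s y.
Proof. by elim: s => [|d s IH] /=; rewrite ?mulr0 // IH zrM; ring. Qed.

Lemma zr0 : zr Z0 = 0. Proof. by []. Qed.
Lemma zrN1 : zr (Zneg 1) = -1. Proof. by []. Qed.
Lemma zr1 : zr (Zpos 1) = 1. Proof. by []. Qed.

Lemma peval_mul s t y : peval (pmul s t) y = peval s y * peval t y.
Proof.
elim: s => [|c s IH] /=; first by rewrite mul0r.
by rewrite peval_add peval_scale /= IH zr0; ring.
Qed.

Lemma peval_exp s n y : peval (pexp s n) y = peval s y ^+ n.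
Proof.
elim: n => [|n IH]; first by rewrite /= zr1 mulr0 addr0.
by rewrite /pexp iterS peval_mul IH exprS.
Qed.

Fixpoint prescale (p : Z) t : seq Z :=
  if t is c :: t' then Z.mul p c :: prescale (Z.mul (Zpos 3) p) t' else [::].

Fixpoint punscale (p : Z) t : seq Z :=
  if t is c :: t' then Z.div c p :: punscale (Z.mul (Zpos 3) p) t' else [::].

Lemma zr_nat n : zr (Z.of_nat n) = n%:R.
Proof. rewrite /zr; have -> : int_of_Z (Z.of_nat n) = n%:Z by lia. exact: pmulrn. Qed.

Lemma peval_rescale p t y : peval (prescale p t) y = zr p * peval t (3%:R * y).
Proof.
elim: t p => [|c t IH] p /=; first by rewrite mulr0.
by rewrite IH !zrM -[zr (Zpos 3)](zr_nat 3); ring.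
Qed.

End ListPolynomials.

(** * Integral polynomials and the lattices *)

Section IntegralPolynomials.
Variable K : comNzRingType.
Implicit Types f g y : K.

Definition zpoly y f := exists p : {poly int}, f = (map_poly intr p).[y].

Lemma zpolyD y f g : zpoly y f -> zpoly y g -> zpoly y (f + g).
Proof. by move=> [p ->] [r ->]; exists (p + r); rewrite rmorphD hornerD. Qed.

Lemma zpolyM y f g : zpoly y f -> zpoly y g -> zpoly y (f * g).
Proof. by move=> [p ->] [r ->]; exists (p * r); rewrite rmorphM hornerM. Qed.

Lemma zpoly_int y (c : int) : zpoly y c%:~R.
Proof. by exists c%:P; rewrite map_polyC hornerC. Qed.

Lemma zpoly_nat y n : zpoly y n%:R.
Proof. by rewrite pmulrn; apply: zpoly_int. Qed.

Lemma zpoly_id y : zpoly y y.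
Proof. by exists 'X; rewrite map_polyX hornerX. Qed.

Lemma zpoly_ind y (P : K -> Prop) :
  (forall c : int, P c%:~R) -> (forall f (c : int), P f -> P (c%:~R + y * f)) ->
  forall f, zpoly y f -> P f.
Proof.
move=> Pc PD f [p ->]; elim/poly_ind: p => [|p c IH].
  by rewrite rmorph0 horner0; apply: (Pc 0).
by rewrite rmorphD rmorphM /= map_polyX map_polyC hornerMXaddC addrC mulrC; apply: PD.
Qed.

Lemma zpoly_peval s y : zpoly y (peval s y).
Proof.
elim: s => [|c s IH]; first exact: (zpoly_int y 0).
by apply: zpolyD; [apply: zpoly_int | apply: zpolyM => //; apply: zpoly_id].
Qed.

Lemma zpoly_trans y y' f : zpoly y y' -> zpoly y' f -> zpoly y f.
Proof.
move=> yy'; elim/zpoly_ind => [c|g c IH]; first exact: zpoly_int.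
by apply: zpolyD; [apply: zpoly_int | apply: zpolyM].
Qed.

Variable x : K.

(* [Zk k] consists of the polynomials in [x] whose [j]-th coefficient is an
   integer divisible by [3 ^ (j - k)] (truncated subtraction). *)
Fixpoint Zk (k : nat) f : Prop :=
  if k is k'.+1 then exists c : int, exists2 g, Zk k' g & f = c%:~R + x * g
  else zpoly (3%:R * x) f.

Lemma Zk_int k (c : int) : Zk k c%:~R.
Proof.
elim: k c => [|k IH] c; first exact: zpoly_int.
by exists c, 0; [apply: (IH 0) | rewrite mulr0 addr0].
Qed.

Lemma ZkD k f g : Zk k f -> Zk k g -> Zk k (f + g).
Proof.
elim: k f g => [|k IH] f g; first exact: zpolyD.
move=> [c [f' Zf ->]] [d [g' Zg ->]].
by exists (c + d), (f' + g'); [apply: IH | rewrite intrD; ring].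
Qed.

Lemma Zk_intM k (c : int) f : Zk k f -> Zk k (c%:~R * f).
Proof.
elim: k f => [|k IH] f; first by apply: zpolyM; apply: zpoly_int.
move=> [d [g Zg ->]]; exists (c * d), (c%:~R * g); first exact: IH.
by rewrite intrM; ring.
Qed.

Lemma Zk_3xM k f : Zk k f -> Zk k (3%:R * x * f).
Proof.
elim: k f => [|k IH] f; first by apply: zpolyM; apply: zpoly_id.
move=> [d [g Zg ->]]; exists 0, ((3%:Z * d)%:~R + 3%:R * x * g).
  by apply: ZkD; [apply: Zk_int | apply: IH].
by rewrite intrM; ring.
Qed.

Lemma Zk_zpolyM k h f : zpoly (3%:R * x) h -> Zk k f -> Zk k (h * f).
Proof.
move=> Zh Zf; elim/zpoly_ind: h / Zh => [c|g c IH]; first exact: Zk_intM.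
rewrite mulrDl -mulrA; apply: ZkD; first exact: Zk_intM.
exact: Zk_3xM.
Qed.

Lemma Zk_zpoly k f : Zk k f -> zpoly x f.
Proof.
elim: k f => [|k IH] f.
  by apply: zpoly_trans; apply: zpolyM; [apply: zpoly_nat | apply: zpoly_id].
move=> [c [g /IH Zg ->]]; apply: zpolyD; first exact: zpoly_int.
by apply: zpolyM => //; apply: zpoly_id.
Qed.

(** For [k = 0], dividing the [j]-th coefficient by [3^j] and multiplying back tests divisibility;
    soundness then rests on the multiplication alone. *)
Fixpoint Zk_check k (s : seq Z) : bool :=
  match k, s with
  | 0, _ => s == prescale (Zpos 1) (punscale (Zpos 1) s)
  | k'.+1, _ :: s' => Zk_check k' s'
  | _, [::] => true
  end.

Lemma Zk_checkP k s : Zk_check k s -> Zk k (peval s x).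
Proof.
elim: k s => [|k IH] s.
  by move=> /eqP ->; rewrite peval_rescale zr1 mul1r; apply: zpoly_peval.
case: s => [|c s] /=; first by move=> _; apply: (Zk_int k.+1 0).
by move=> /IH Zs; exists (int_of_Z c), (peval s x).
Qed.

Lemma pdiv_checkP d (s : seq Z) : s == pscale (Z.of_nat d) [seq Z.div c (Z.of_nat d) | c <- s] ->
  peval s x = d%:R * peval [seq Z.div c (Z.of_nat d) | c <- s] x.
Proof. by move=> /eqP E; rewrite [in LHS]E peval_scale zr_nat. Qed.

Definition M1 f := exists c d : int, exists2 g, Zk 4 g &
  f = c%:~R * (x - x ^+ 2) + d%:~R * (x ^+ 2 - x ^+ 3) + 9%:R * g.

Lemma M1D f g : M1 f -> M1 g -> M1 (f + g).
Proof.
move=> [c [d [f' Zf ->]]] [c' [d' [g' Zg ->]]].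
exists (c + c'), (d + d'), (f' + g'); first exact: ZkD.
by rewrite !intrD; ring.
Qed.

Lemma M1_intM (a : int) f : M1 f -> M1 (a%:~R * f).
Proof.
move=> [c [d [g Zg ->]]]; exists (a * c), (a * d), (a%:~R * g); first exact: Zk_intM.
by rewrite !intrM; ring.
Qed.

Lemma M1_9Zk f : Zk 4 f -> M1 (9%:R * f).
Proof. by move=> Zf; exists 0, 0, f => //; rewrite !mul0r !add0r. Qed.

(** Multiplication by [9 x] sends [M1] into [9 Zk 4]: [x] times either generator has degree at most
    4, where [Zk 4] imposes no divisibility, and [x (9 g) = 3 (3 x g)]. *)
Lemma M1_zpolyM h f : zpoly (9%:R * x) h -> M1 f -> M1 (h * f).
Proof.
move=> Zh Mf; elim/zpoly_ind: h / Zh => [a|g a IH]; first exact: M1_intM.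
rewrite mulrDl -mulrA; apply: M1D; first exact: M1_intM.
case: IH => c [d [g' Zg ->]]; rewrite -mulrA; apply: M1_9Zk.
have -> : x * (c%:~R * (x - x ^+ 2) + d%:~R * (x ^+ 2 - x ^+ 3) + 9%:R * g') =
  0%:~R + x * (0%:~R + x * (c%:~R + x * ((d - c)%:~R + x * (- d)%:~R)))
  + 3%:Z%:~R * (3%:R * x * g').
  by rewrite intrB rmorphN /=; ring.
apply: ZkD; last by apply: Zk_intM; apply: Zk_3xM.
exists 0; eexists; last by []; exists 0; eexists; last by [].
exists c; eexists; last by []; exists (d - c); eexists; last by [].
exact: zpoly_int.
Qed.

Lemma M1_zpoly f : M1 f -> zpoly x f.
Proof.
have Zn n m : zpoly x (x ^+ n - x ^+ m).
  by exists ('X^n - 'X^m); rewrite rmorphB /= !map_polyXn hornerD hornerN !hornerXn.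
move=> [c [d [g /Zk_zpoly Zg ->]]].
apply: zpolyD; first apply: zpolyD; apply: zpolyM => //; try exact: zpoly_int.
- exact: (Zn 1).
- exact: zpoly_nat.
Qed.

(** Modulo 9 the coefficients of [x] and [x^2] are [c] and [d - c], which determines [c] and [d]
    modulo 9; a different choice changes the remainder by an element of [9 Zk 4]. *)
Definition M1_check (s : seq Z) : bool :=
  let c := nth Z0 s 1 in
  let d := Z.add c (nth Z0 s 2) in
  let r := padd s (padd (pscale c [:: Z0; Zneg 1; Zpos 1])
                        (pscale d [:: Z0; Z0; Zneg 1; Zpos 1])) in
  let g := [seq Z.div a (Z.of_nat 9) | a <- r] in
  (r == pscale (Z.of_nat 9) g) && Zk_check 4 g.

Lemma M1_checkP s : M1_check s -> M1 (peval s x).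
Proof.
rewrite /M1_check; set c := nth _ _ _; set d := Z.add _ _; set r := padd _ _.
set g := map _ _ => /andP[/pdiv_checkP rE /Zk_checkP Zg].
exists (int_of_Z c), (int_of_Z d), (peval g x) => //.
rewrite -rE /r !peval_add !peval_scale /zr; move: (peval s x) (int_of_Z c) (int_of_Z d).
by move=> a c' d' /=; rewrite zr0 zrN1 zr1; ring.
Qed.

End IntegralPolynomials.

(** * The action of the trace on the lattices *)

(* The equation of [w] gives [u_{i+3} = x (12 u_{i+2} + 6 u_{i+1} + u_i)] for
   [u_i = U_3(w^i)]. *)
Fixpoint trace_list (s a b c : seq Z) : seq Z :=
  if s is d :: s' then
    padd (pscale d a) (trace_list s' b c
      (Z0 :: padd (pscale (Z.of_nat 12) c) (padd (pscale (Z.of_nat 6) b) a)))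
  else [::].

(** The initial lists are [U_3(1)], [U_3(w)] and [U_3(w^2)] as polynomials in [x]. *)
Definition utrace (s : seq Z) : seq Z :=
  trace_list s [:: Zpos 1] [:: Z0; Z.of_nat 4] [:: Z0; Z.of_nat 4; Z.of_nat 48].

Definition xlist : seq Z := [:: Z0; Zpos 1; Zpos 3; Zpos 3].
Definition Wlist : seq Z := [:: Z0; Zpos 3].
Definition Alist : seq Z := pmul [:: Z0; Zpos 1] (pexp [:: Zpos 1; Zpos 2] 4).

Definition divisible_check (d : nat) (P : seq Z -> bool) (s : seq Z) : bool :=
  let g := [seq Z.div a (Z.of_nat d) | a <- s] in (s == pscale (Z.of_nat d) g) && P g.

Definition xW m i := pmul (pexp xlist m) (pexp Wlist i).
Definition Dlist m i := padd (xW m i) (pscale (Zneg 1) (xW m.+1 i)).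

Definition check_all (ms : seq nat) (P : nat -> nat -> bool) : bool :=
  all (fun m => all (P m) [:: 0; 1; 2]%N) ms.

(** The powers [x^m], [m <= 4], generate [Zk 4] over [Z[3 x]], and 1, [W], [W^2] generate [span], so
    these fifteen traces decide [U_Zk4]. *)
Lemma check_U1_Z4 :
  check_all [:: 0; 1; 2; 3; 4]%N (fun m i => Zk_check 3 (utrace (xW m i))).
Proof. by vm_compute. Qed.

Lemma check_U1_D :
  check_all [:: 1; 2]%N (fun m i => divisible_check 3 (Zk_check 3) (utrace (Dlist m i)))
  && all (fun m => divisible_check 9 (Zk_check 3) (utrace (Dlist m 0))) [:: 1; 2]%N.
Proof. by vm_compute. Qed.

Lemma check_U0_M1 :
  check_all [:: 0; 1; 2; 3]%N (fun m i => M1_check (utrace (pmul Alist (xW m i)))).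
Proof. by vm_compute. Qed.

Lemma check_U0_x4 : check_all [:: 4]%N
  (fun m i => divisible_check 3 (Zk_check 4) (utrace (pmul Alist (xW m i)))).
Proof. by vm_compute. Qed.

Lemma check_U0_1 : check_all [:: 0]%N
  (fun m i => divisible_check 3 M1_check (utrace (pmul Alist (xW m i)))).
Proof. by vm_compute. Qed.

Lemma check_allP ms P m i : check_all ms P -> m \in ms -> (i < 3)%N -> P m i.
Proof.
move=> /allP C mi i3; have /allP := C m mi; apply.
by case: i i3 => [|[|[|//]]].
Qed.

(** * The trace over an abstract ring, with [V] for [q -> q^3] and [U] for [U_3] *)

Section Operator.
Variables (K : comNzRingType) (V : {rmorphism K -> K}) (U : {additive K -> K}).
Variables (x w : K).
Hypothesis U_V : forall f g, U (V f * g) = f * U g.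
Hypothesis U_1 : U 1 = 1.
Hypothesis U_w : U w = 4%:R * x.
Hypothesis U_w2 : U (w ^+ 2) = 4%:R * x + 48%:R * x ^+ 2.
Hypothesis x_w : x = w + 3%:R * w ^+ 2 + 3%:R * w ^+ 3.
Hypothesis w_cubic : w ^+ 3 = V x * (12%:R * w ^+ 2 + 6%:R * w + 1).

Lemma U_intM (c : int) f : U (c%:~R * f) = c%:~R * U f.
Proof. by rewrite -{1}(rmorph_int V c) U_V. Qed.

Lemma U_natM n f : U (n%:R * f) = n%:R * U f.
Proof. by rewrite pmulrn U_intM. Qed.

Lemma U_w3 k : U (w ^+ k.+3) =
  x * (12%:R * U (w ^+ k.+2) + (6%:R * U (w ^+ k.+1) + U (w ^+ k))).
Proof.
rewrite -!U_natM -!raddfD -U_V; congr (U _).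
transitivity (w ^+ k * w ^+ 3); first by rewrite -exprD addn3.
by rewrite w_cubic !exprS; ring.
Qed.

Lemma trace_listP s k a b c : peval a x = U (w ^+ k) ->
  peval b x = U (w ^+ k.+1) -> peval c x = U (w ^+ k.+2) ->
  peval (trace_list s a b c) x = U (w ^+ k * peval s w).
Proof.
elim: s k a b c => [|d s IH] k a b c Ea Eb Ec; first by rewrite mulr0 raddf0.
rewrite peval_add peval_scale Ea (IH k.+1) //.
  rewrite /zr -U_intM -raddfD; congr (U _).
  by rewrite /= exprS; ring.
rewrite U_w3 -Ea -Eb -Ec -!(zr_nat K) -!peval_scale -!peval_add.
by rewrite [LHS]/= zr0 add0r.
Qed.

Lemma utraceP s : peval (utrace s) x = U (peval s w).
Proof.
rewrite -[in RHS](mul1r (peval s w)) -[1](expr0 w); apply: trace_listP.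
- by rewrite expr0 U_1 /= zr1 mulr0 addr0.
- by rewrite expr1 U_w /= zr0 (zr_nat K 4); ring.
- by rewrite U_w2 [LHS]/= zr0 (zr_nat K 4) (zr_nat K 48); ring.
Qed.

Let W := 3%:R * w.

Lemma peval_xW m i : peval (xW m i) w = x ^+ m * W ^+ i.
Proof.
rewrite peval_mul !peval_exp; congr (_ ^+ _ * _ ^+ _).
  by rewrite /= zr0 zr1 (zr_nat K 3) x_w; ring.
by rewrite /= zr0 (zr_nat K 3); rewrite /W; ring.
Qed.

Lemma peval_Alist : peval Alist w = w * (1 + 2%:R * w) ^+ 4.
Proof.
rewrite peval_mul peval_exp /= zr0 zr1 (zr_nat K 2).
by congr (_ * _ ^+ _); ring.
Qed.

Lemma peval_Dlist m i : peval (Dlist m i) w = (x ^+ m - x ^+ m.+1) * W ^+ i.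
Proof. by rewrite peval_add peval_scale !peval_xW zrN1; ring. Qed.

Definition multiple (d : nat) (N : K -> Prop) f := exists2 g, N g & f = d%:R * g.

Lemma divisible_checkP d (P : seq Z -> bool) (N : K -> Prop) s :
  (forall t, P t -> N (peval t x)) -> divisible_check d P s ->
  multiple d N (peval s x).
Proof. by move=> PN /andP[/pdiv_checkP -> /PN Ng]; eexists; first exact: Ng. Qed.

(** The module generated by 1, [W], [W^2] over the image of [Z[y]] under [V]. [W_cubic] makes it a
    ring once [9 x] lies in [Z[y]]; it is used for [y = 9 x] and [y = 3 x]. *)
Definition span (y f : K) := exists g : K * K * K,
  [/\ zpoly y g.1.1, zpoly y g.1.2, zpoly y g.2 &
      f = V g.1.1 + V g.1.2 * W + V g.2 * W ^+ 2].

Section Span.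
Variable y : K.
Hypothesis y9 : zpoly y (9%:R * x).

Lemma span_V h : zpoly y h -> span y (V h).
Proof.
move=> Zh; exists (h, 0, 0); split => //=; try exact: (zpoly_int y 0).
by rewrite rmorph0; ring.
Qed.

Lemma spanD f g : span y f -> span y g -> span y (f + g).
Proof.
move=> [[[a b] c] /= [Za Zb Zc ->]] [[[a' b'] c'] /= [Za' Zb' Zc' ->]].
exists (a + a', b + b', c + c'); split; try exact: zpolyD.
by rewrite /= !rmorphD; ring.
Qed.

Lemma span_VM h f : zpoly y h -> span y f -> span y (V h * f).
Proof.
move=> Zh [[[a b] c] /= [Za Zb Zc ->]].
exists (h * a, h * b, h * c); split; try exact: zpolyM.
by rewrite /= !rmorphM; ring.
Qed.

Lemma W_cubic : W ^+ 3 = V (9%:R * x) * (4%:R * W ^+ 2 + 6%:R * W + 3%:R).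
Proof.
by rewrite /W exprMn w_cubic rmorphM rmorph_nat; ring.
Qed.

Lemma span_WM f : span y f -> span y (W * f).
Proof.
move=> [[[a b] c] /= [Za Zb Zc ->]].
exists (c * (9%:R * x) * 3%:R, a + c * (9%:R * x) * 6%:R, b + c * (9%:R * x) * 4%:R).
have Zc9 n : zpoly y (c * (9%:R * x) * n%:R).
  by apply: zpolyM; [apply: zpolyM | apply: zpoly_nat].
split => /=; [exact: Zc9 | exact: zpolyD | exact: zpolyD |].
transitivity (V a * W + V b * W ^+ 2 + V c * W ^+ 3); first by ring.
by rewrite W_cubic; ring.
Qed.

Lemma spanM f g : span y f -> span y g -> span y (f * g).
Proof.
move=> [[[a b] c] /= [Za Zb Zc ->]] Sg.
have -> : (V a + V b * W + V c * W ^+ 2) * g =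
  V a * g + V b * (W * g) + V c * (W * (W * g)) by ring.
by apply: spanD; first apply: spanD; apply: span_VM => //; do ?apply: span_WM.
Qed.

Lemma span_int (c : int) : span y c%:~R.
Proof. by rewrite -(rmorph_int V); apply: span_V; apply: zpoly_int. Qed.

Lemma span_nat n : span y n%:R.
Proof. by rewrite pmulrn; apply: span_int. Qed.

Lemma span_W : span y W.
Proof. by rewrite -[W]mulr1; apply: span_WM; apply: (span_nat 1). Qed.

Lemma spanX n f : span y f -> span y (f ^+ n).
Proof.
move=> Sf; elim: n => [|n IH]; first exact: (span_nat 1).
by rewrite exprS; apply: spanM.
Qed.

Lemma U_span (N : K -> Prop) h b :
  (forall f g, N f -> N g -> N (f + g)) -> (forall f g, zpoly y f -> N g -> N (f * g)) ->
  (forall i, (i < 3)%N -> N (U (h * W ^+ i))) -> span y b -> N (U (h * b)).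
Proof.
move=> ND NM NU [[[f0 f1] f2] /= [Z0 Z1 Z2 ->]].
have -> : h * (V f0 + V f1 * W + V f2 * W ^+ 2) =
  V f0 * (h * W ^+ 0) + V f1 * (h * W ^+ 1) + V f2 * (h * W ^+ 2).
  by ring.
by rewrite !raddfD !U_V; apply: (ND); first apply: (ND); apply: (NM) => //; apply: NU.
Qed.

End Span.

Lemma zpoly_3x_9x : zpoly (3%:R * x) (9%:R * x).
Proof.
have -> : 9%:R * x = 3%:R * (3%:R * x) by ring.
by apply: zpolyM; [apply: zpoly_nat | apply: zpoly_id].
Qed.

Lemma span_le f : span (9%:R * x) f -> span (3%:R * x) f.
Proof.
have Z93 := zpoly_3x_9x.
move=> [[[a b] c] /= [Za Zb Zc ->]]; exists (a, b, c).
by split => //=; apply: zpoly_trans Z93 _.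
Qed.

Lemma zpoly_span f : zpoly (3%:R * x) f -> span (3%:R * x) f.
Proof.
have Z93 := zpoly_3x_9x.
have Sx : span (3%:R * x) (3%:R * x).
  (* In [3 x = 3 w + 9 w^2 + 9 w^3] the cubic term is reduced by [w_cubic]. *)
  have E : 3%:R * x =
      W + W ^+ 2 + V (3%:R * x) * (4%:R * W ^+ 2 + 6%:R * W + 3%:R).
    rewrite rmorphM rmorph_nat {1}x_w.
    transitivity (3%:R * w + 9%:R * w ^+ 2 + 9%:R * w ^+ 3); first by ring.
    by rewrite w_cubic /W; ring.
  rewrite {2}E; apply: spanD; first apply: spanD; last apply: span_VM (zpoly_id _) _.
  - exact: span_W.
  - by apply: spanX => //; apply: span_W.
  - by apply: spanD; [apply: spanD|apply: span_nat];
      apply: spanM => //; try apply: spanX => //; try exact: span_nat; apply: span_W.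
elim/zpoly_ind => [c|g c IH]; first exact: span_int.
by apply: spanD; [apply: span_int | apply: spanM].
Qed.

(** The coefficients of [g] are peeled off one at a time while [h] collects the powers of [x]; the
    remaining factor in [Z[3 x]] is absorbed into [span]. *)
Lemma U_Zk (N : K -> Prop) k h g b :
  (forall f g, N f -> N g -> N (f + g)) ->
  (forall f g, zpoly (3%:R * x) f -> N g -> N (f * g)) ->
  (forall m i, (m <= k)%N -> (i < 3)%N -> N (U (h * (x ^+ m * W ^+ i)))) ->
  Zk x k g -> span (3%:R * x) b -> N (U (h * g * b)).
Proof.
have Z93 := zpoly_3x_9x.
move=> ND NM; elim: k h g => [|k IH] h g NU.
  move=> /zpoly_span Sg Sb; rewrite -mulrA; apply: (U_span ND NM) => [i i3|].
    by rewrite -[W ^+ i]mul1r; apply: (NU 0%N).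
  exact: spanM.
move=> [c [g' Zg ->]] Sb.
have -> : h * (c%:~R + x * g') * b = h * (c%:~R * b) + h * x * g' * b by ring.
rewrite raddfD; apply: (ND).
  apply: (U_span ND NM) => [i i3|]; first by rewrite -[W ^+ i]mul1r; apply: (NU 0%N).
  by apply: spanM => //; apply: span_int.
apply: IH => // m i mk i3.
by have := NU m.+1 i mk i3; rewrite exprS !mulrA.
Qed.

Lemma multipleD d (N : K -> Prop) :
  (forall f g, N f -> N g -> N (f + g)) ->
  forall f g, multiple d N f -> multiple d N g -> multiple d N (f + g).
Proof.
by move=> ND f g [f' Nf ->] [g' Ng ->]; exists (f' + g'); [apply: ND | rewrite mulrDr].
Qed.

Lemma multiple_zpolyM y d (N : K -> Prop) :
  (forall f g, zpoly y f -> N g -> N (f * g)) ->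
  forall f g, zpoly y f -> multiple d N g -> multiple d N (f * g).
Proof.
by move=> NM f g Zf [g' Ng ->]; exists (f * g'); [apply: NM | rewrite mulrCA].
Qed.

(** The product of the other two conjugates of [1 + W] under its cubic equation; it turns the
    denominator [1 + W] into [V (1 + 9 x)], which leaves [U]. *)
Let sigma := 1 - W + W ^+ 2 + V (9%:R * x) * (- 2%:R - 4%:R * W).

Lemma W_sigma : (1 + W) * sigma = V (1 + 9%:R * x).
Proof.
transitivity (1 + W ^+ 3 + V (9%:R * x) * (- 2%:R - 4%:R * W) * (1 + W)).
  by rewrite /sigma; ring.
by rewrite W_cubic rmorphD rmorph1; ring.
Qed.

Lemma W_cube : (1 + W) ^+ 3 = 1 + 9%:R * x.
Proof. by rewrite [in RHS]x_w /W; ring. Qed.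

Let S9 := span (9%:R * x).
Let Z99 : zpoly (9%:R * x) (9%:R * x) := zpoly_id _.
Let S9W : S9 W := span_W Z99.
Let S9D f g : S9 f -> S9 g -> S9 (f + g) := @spanD _ f g.
Let S9M f g : S9 f -> S9 g -> S9 (f * g) := @spanM _ Z99 f g.
Let S9n n : S9 n%:R := span_nat _ n.
Let S9c (c : int) : S9 c%:~R := span_int _ c.
Let S9X n f : S9 f -> S9 (f ^+ n) := @spanX _ Z99 n f.
Let S9V : S9 (V (9%:R * x)) := span_V Z99.

Lemma span_sigma : S9 sigma.
Proof.
have -> : sigma = 1%:R + (-1)%:~R * W + W ^+ 2 + V (9%:R * x) * ((-2)%:~R + (-4)%:~R * W).
  by rewrite /sigma; ring.
do ![apply: S9D]; rewrite -/S9; try exact: S9n; try exact: S9X.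
  exact: S9M.
by apply: S9M => //; apply: S9D; [apply: S9c | apply: S9M].
Qed.

(* [sigma ^ 3] is 1 modulo this ideal, because [W ^ 3] is 0 modulo [9 x(q^3)].  This is
   needed as [U_3 (D b)], for [D = x - x^2] or [x^2 - x^3], is in general only divisible
   by 3, but by 9 for [b = 1]. *)
Definition ideal9 f := exists b c, [/\ S9 b, S9 c & f = 3%:R * b + V (9%:R * x) * c].

Lemma ideal9D f g : ideal9 f -> ideal9 g -> ideal9 (f + g).
Proof.
move=> [b [c [Sb Sc ->]]] [b' [c' [Sb' Sc' ->]]].
by exists (b + b'), (c + c'); split; [apply: S9D | apply: S9D | ring].
Qed.

Lemma ideal9M f g : S9 f -> ideal9 g -> ideal9 (f * g).
Proof.
move=> Sf [b [c [Sb Sc ->]]].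
by exists (f * b), (f * c); split; [apply: S9M | apply: S9M | ring].
Qed.

Lemma ideal9_span f : ideal9 f -> S9 f.
Proof. by move=> [b [c [Sb Sc ->]]]; apply: S9D; apply: S9M. Qed.

Lemma sigma_exp n : exists2 i, ideal9 i & sigma ^+ (3 * n) = 1 + i.
Proof.
have [i Ii E] : exists2 i, ideal9 i & sigma ^+ 3 = 1 + i.
  pose y := V (9%:R * x); pose c := (-2)%:~R + (-4)%:~R * W.
  pose s := 1 + (-1)%:~R * W + W ^+ 2.
  have Sc : S9 c by apply: S9D; [apply: S9c | apply: S9M].
  have Ss : S9 s.
    apply: S9D; last exact: S9X.
    by apply: S9D; [apply: (S9n 1) | apply: S9M].
  (* Here [s^3 = 1 - 3 W + 6 W^2 + W^3 (-7 + 6 W - 3 W^2 + W^3)], with the outer [W^3] rewritten by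
     [W_cubic]; the summand with factor [c] is [((s + y c)^3 - s^3) / y]. *)
  exists (3%:R * ((-1)%:~R * W + 2%:R * W ^+ 2) + V (9%:R * x) *
    ((4%:R * W ^+ 2 + 6%:R * W + 3%:R) *
      ((-7)%:~R + 6%:R * W + (-3)%:~R * W ^+ 2 + W ^+ 3)
     + c * (3%:R * s ^+ 2 + 3%:R * (s * (y * c)) + (y * c) ^+ 2))).
    exists ((-1)%:~R * W + 2%:R * W ^+ 2).
    eexists; split; last by [].
      by apply: S9D; apply: S9M => //; apply: S9X.
    by do ?[exact: S9n | exact: S9c | exact: S9W | exact: S9V | done
           | apply: S9D | apply: S9X | apply: S9M].
  have -> : sigma = s + y * c by rewrite /sigma /s /y /c; ring.
  transitivity (1 + 3%:R * ((-1)%:~R * W + 2%:R * W ^+ 2) +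
     W ^+ 3 * ((-7)%:~R + 6%:R * W + (-3)%:~R * W ^+ 2 + W ^+ 3)
     + y * c * (3%:R * s ^+ 2 + 3%:R * (s * (y * c)) + (y * c) ^+ 2)).
    by rewrite /s; ring.
  by rewrite {1}W_cubic -/y; ring.
elim: n => [|n [j Ij IH]].
  exists 0; last by rewrite muln0 addr0.
  exists 0, 0; split; [exact: (S9n 0)|exact: (S9n 0)|ring].
exists (i + j + i * j).
  apply: ideal9D; first exact: ideal9D.
  by apply: ideal9M => //; apply: ideal9_span.
by rewrite mulnS exprD E IH; ring.
Qed.

Lemma U_Zk4 g b : Zk x 4 g -> S9 b -> Zk x 3 (U (g * b)).
Proof.
move=> Zg /span_le Sb; rewrite -[g]mul1r.
apply: (U_Zk (N := Zk x 3) _ _ _ Zg Sb); [exact: ZkD | exact: Zk_zpolyM |].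
move=> m i m4 i3; rewrite mul1r -peval_xW -utraceP; apply: Zk_checkP.
by apply: (check_allP check_U1_Z4) => //; rewrite !inE; lia.
Qed.

(** The factor 9 arises in three ways: by computation for 1, as 3 times 3 for [3 b], and for
    [V (9 x) c] as [9 x] times a multiple of 3, where [3 x] preserves [Zk 3]. *)
Lemma U_D m i : (m == 1%N) || (m == 2%N) -> ideal9 i ->
  multiple 9 (Zk x 3) (U ((x ^+ m - x ^+ m.+1) * (1 + i))).
Proof.
move=> m12 [b [c [Sb Sc ->]]]; have /andP[C3 /allP C9] := check_U1_D.
have m12' : m \in [:: 1; 2]%N by rewrite !inE.
set D := _ - _.
have UD b' : S9 b' -> multiple 3 (Zk x 3) (U (D * b')).
  apply: U_span => [f g|f g Zf|j j3].
  - exact/multipleD/ZkD.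
  - apply: multiple_zpolyM Zf => {f} f h Zf; apply: Zk_zpolyM.
    exact: zpoly_trans zpoly_3x_9x Zf.
  rewrite -peval_Dlist -utraceP.
  apply: divisible_checkP (check_allP C3 m12' j3); exact: Zk_checkP.
have [g Zg gE] : multiple 9 (Zk x 3) (U D).
  rewrite -[D]mulr1 -[1](expr0 W) -peval_Dlist -utraceP.
  by apply: divisible_checkP (C9 _ m12'); exact: Zk_checkP.
have [h Zh hE] := UD b Sb; have [k Zk' kE] := UD c Sc.
exists (g + h + 3%:R * x * k).
  by apply: ZkD; [apply: ZkD | apply: Zk_3xM].
have -> : D * (1 + (3%:R * b + V (9%:R * x) * c)) =
  D + 3%:R * (D * b) + V (9%:R * x) * (D * c) by ring.
by rewrite 2!raddfD U_natM U_V gE hE kE; ring.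
Qed.

(** The factor [(1 + 9 x)^(3n)] enters [U] as [V (1 + 9 x)^(3n) = (1 + 9 x)^n sigma^(3n)], by
    [W_sigma] and [W_cube]; this is why [n] triples. *)
Lemma U1_step n c F f : M1 x f -> (1 + 9%:R * x) ^+ n * F = c%:R * f ->
  exists2 g, Zk x 3 g & (1 + 9%:R * x) ^+ (3 * n) * U F = (c * 9)%:R * g.
Proof.
move=> [a [d [g Zg fE]]] FE; have [i Ii sE] := sigma_exp n.
have -> : (1 + 9%:R * x) ^+ (3 * n) * U F = c%:R * U (f * (1 + i)).
  rewrite -U_V -U_natM; congr (U _).
  rewrite rmorphXn /= -W_sigma exprMn exprM W_cube -sE.
  by transitivity ((1 + 9%:R * x) ^+ n * F * sigma ^+ (3 * n)); [ring | rewrite FE; ring].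
have [g1 Zg1 E1] := U_D (isT : (1 == 1%N) || (1 == 2)%N) Ii.
have [g2 Zg2 E2] := U_D (isT : (2 == 1%N) || (2 == 2)%N) Ii.
have Zg3 : Zk x 3 (U (g * (1 + i))).
  by apply: U_Zk4 => //; apply: S9D; [apply: (S9n 1) | apply: ideal9_span].
exists (a%:~R * g1 + d%:~R * g2 + U (g * (1 + i))).
  by apply: ZkD => //; apply: ZkD; apply: Zk_intM.
have -> : f * (1 + i) = a%:~R * ((x ^+ 1 - x ^+ 2) * (1 + i)) +
  d%:~R * ((x ^+ 2 - x ^+ 3) * (1 + i)) + 9%:R * (g * (1 + i)).
  by rewrite fE; ring.
by rewrite !raddfD !U_intM U_natM E1 E2 natrM; ring.
Qed.

Variable A : K.
Hypothesis A_w : A * (1 + W) = w * (1 + 2%:R * w) ^+ 4.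
Let A' := w * (1 + 2%:R * w) ^+ 4.

Lemma peval_AxW m i : peval (pmul Alist (xW m i)) w = A' * x ^+ m * W ^+ i.
Proof. by rewrite peval_mul peval_Alist peval_xW mulrA. Qed.

(** [M1] is only known to be a module over [Z[9 x]], so [f] is split as a cubic polynomial plus
    [3 x^4 g] with [g] in [Z[3 x]]. The trace of the [x^4] part lies in [3 Zk 4], and the factor 3
    in front completes [9 Zk 4]. *)
Lemma U_A_Zk3 f b : Zk x 3 f -> S9 b -> M1 x (U (A' * f * b)).
Proof.
have UA m b' : (m <= 3)%N -> S9 b' -> M1 x (U (A' * x ^+ m * b')).
  move=> m3; apply: U_span => [g h|g h|i i3]; [exact: M1D|exact: M1_zpolyM|].
  rewrite -peval_AxW -utraceP; apply/M1_checkP/(check_allP check_U0_M1) => //.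
  by rewrite !inE; lia.
have UA4 b' : span (3%:R * x) b' -> multiple 3 (Zk x 4) (U (A' * x ^+ 4 * b')).
  apply: U_span => [g h|g h Zg|i i3].
  - exact/multipleD/ZkD.
  - by apply: multiple_zpolyM Zg; apply: Zk_zpolyM.
  rewrite -peval_AxW -utraceP.
  apply: divisible_checkP (check_allP check_U0_x4 (isT : 4 \in [:: 4]%N) i3).
  exact: Zk_checkP.
move=> [c0 [_ [c1 [_ [c2 [g0 Zg0 ->]] ->]] ->]] Sb.
have [c3 [g Zg ->]] : exists c3 : int,
    exists2 g, zpoly (3%:R * x) g & g0 = c3%:~R + 3%:R * x * g.
  elim/zpoly_ind: g0 / Zg0 => [c|g c [d [h Zh ->]]].
    by exists c, 0; [apply: (zpoly_int _ 0) | ring].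
  exists c, (d%:~R + 3%:R * x * h) => //; apply: zpolyD; first exact: zpoly_int.
  by apply: zpolyM => //; apply: zpoly_id.
have [h Zh hE] : multiple 3 (Zk x 4) (U (A' * x ^+ 4 * (g * b))).
  apply: UA4; apply: (spanM zpoly_3x_9x); first exact: zpoly_span.
  exact: span_le.
have -> : A' * (c0%:~R + x * (c1%:~R + x * (c2%:~R + x * (c3%:~R + 3%:R * x * g)))) * b =
  c0%:~R * (A' * x ^+ 0 * b) + c1%:~R * (A' * x ^+ 1 * b) + c2%:~R * (A' * x ^+ 2 * b)
  + c3%:~R * (A' * x ^+ 3 * b) + 3%:R * (A' * x ^+ 4 * (g * b)) by ring.
rewrite !raddfD !U_intM U_natM hE; do 4?apply: M1D; try by apply: M1_intM; apply: UA.
have -> : 3%:R * (3%:R * h) = 9%:R * h by ring.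
exact: M1_9Zk.
Qed.

(** Compared with [U1_step], one more factor [V (1 + 9 x) = (1 + W) sigma] clears the denominator
    [1 + W] of [A]. *)
Lemma U0_step n c F f : Zk x 3 f -> (1 + 9%:R * x) ^+ n * F = c%:R * f ->
  exists2 g, M1 x g & (1 + 9%:R * x) ^+ (3 * n).+1 * U (A * F) = c%:R * g.
Proof.
move=> Zf FE; exists (U (A' * f * sigma ^+ (3 * n).+1)).
  by apply: U_A_Zk3 => //; apply: S9X; apply: span_sigma.
rewrite -U_V -U_natM; congr (U _).
rewrite rmorphXn /= -W_sigma exprMn exprS exprM W_cube /A' -A_w.
transitivity (A * (1 + W) * ((1 + 9%:R * x) ^+ n * F) * sigma ^+ (3 * n).+1); first by ring.
by rewrite FE; ring.
Qed.

Lemma U0_base : exists2 g, M1 x g & (1 + 9%:R * x) * U A = 3%:R * g.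
Proof.
have -> : (1 + 9%:R * x) * U A = U (A' * x ^+ 0 * sigma).
  by rewrite -U_V -W_sigma; congr (U _); rewrite /A' -A_w; ring.
have [g Mg ->] : multiple 3 (M1 x) (U (A' * x ^+ 0 * sigma)).
  apply: U_span span_sigma => [g h|g h Zg|i i3].
  - exact/multipleD/M1D.
  - by apply: multiple_zpolyM Zg; apply: M1_zpolyM.
  rewrite -peval_AxW -utraceP.
  apply: divisible_checkP (check_allP check_U0_1 (isT : 0 \in [:: 0]%N) i3).
  exact: M1_checkP.
by exists g.
Qed.

End Operator.

(** * Induction on the index of [L] *)

Fact U3_zmod_morphism : zmod_morphism U3.
Proof. by move=> f g; apply/fpsP. Qed.

HB.instance Definition _ :=
  GRing.isZmodMorphism.Build {fps rat} {fps rat} U3 U3_zmod_morphism.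

Lemma U3_1 : U3 1 = 1.
Proof. by rewrite -[X in U3 X](rmorph1 (@fps_cube rat)) part3_cube. Qed.

Local Notation x9 := (1 + 9%:R * xser).

Lemma L_even_step k n f : M1 xser f ->
  x9 ^+ n * L (2 * k).+1 = (3 ^ (2 * k).+1)%:R * f ->
  exists2 g, Zk xser 3 g & x9 ^+ (3 * n) * L (2 * k).+2 = (3 ^ (2 * k).+3)%:R * g.
Proof.
move=> Mf fE; rewrite L_even.
have [g Zg gE] := U1_step U3_cube U3_1 U3_wser U3_wser2 xser_wser wser_cubic Mf fE.
by exists g => //; rewrite gE; congr (_%:R * _); rewrite !expnS; lia.
Qed.

(** The exponents of [1 + 9 x] are 1, 3, 10, 30, ...: [U_3] triples them and [U_3 (A .)] triples and
    adds 1, which matches the floor of [3^(alpha+1) / 8] because [9^k = 1] modulo 8. Only the steps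
    by [U_3] gain powers of 3, namely 9 each. *)
Lemma L_odd_numerator k : exists2 f, M1 xser f &
  x9 ^+ (3 ^ (2 * k).+2 %/ 8) * L (2 * k).+1 = (3 ^ (2 * k).+1)%:R * f.
Proof.
elim: k => [|k [f Mf fE]].
  have := U0_base U3_cube U3_1 U3_wser U3_wser2 xser_wser wser_cubic Aser_wser.
  by move=> [g Mg gE]; exists g; rewrite // L1 -gE.
have [g Zg gE] := L_even_step Mf fE.
have := U0_step U3_cube U3_1 U3_wser U3_wser2 xser_wser wser_cubic Aser_wser Zg gE.
rewrite /= -L_odd => -[h Mh hE].
exists h; rewrite // mulnS; move: hE; rewrite -[(2 + 2 * k).+1]/(2 * k).+3 => <-.
congr (_ ^+ _ * _); rewrite -[(2 + 2 * k).+2]/(2 * k).+4 !expnS.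
have : (9 ^ k %% 8 = 1)%N by elim: k {f Mf fE g Zg gE h Mh} => // k; rewrite expnS; lia.
by rewrite expnM -[(3 ^ 2)%N]/9%N; lia.
Qed.

Theorem theorem1p3 (alpha : nat) (halpha : (1 <= alpha)%N) :
  let psi := (3 ^ alpha.+1 %/ 8)%N in
  let beta := (2 * (alpha %/ 2) + 1)%N in
  exists P : {poly int},
    (1 + 9%:R * xser) ^+ psi / 3%:R ^+ beta * L alpha
      = (map_poly intr P).[xser].
Proof.
move=> psi beta.
suff [f [P ->] fE] : exists2 f, zpoly xser f &
    x9 ^+ psi * L alpha = (3 ^ beta)%:R * f.
  exists P; rewrite mulrAC fE natrX mulrC mulKr //.
  by rewrite unitrX ?fps_natr_unit.
rewrite /psi /beta {psi beta}; have [k [E|E]] : exists k, alpha = (2 * k).+1 \/ alpha = (2 * k).+2.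
- by exists (alpha.-1 %/ 2)%N; lia.
- have [f Mf fE] := L_odd_numerator k; exists f; first exact: M1_zpoly.
  by rewrite E fE; congr ((3 ^ _)%:R * _); lia.
have [f Mf fE] := L_odd_numerator k; have [g Zg gE] := L_even_step Mf fE.
exists g; first exact: Zk_zpoly Zg.
rewrite E; transitivity ((3 ^ (2 * k).+3)%:R * g); last by congr ((3 ^ _)%:R * _); lia.
rewrite -gE; congr (_ ^+ _ * _); rewrite !expnS.
have : (9 ^ k %% 8 = 1)%N by elim: k {E f Mf fE g Zg gE} => // k; rewrite expnS; lia.
by rewrite expnM -[(3 ^ 2)%N]/9%N; lia.
Qed.
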